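(* Let $R$ and $S$ be arbitrary rings and let ${}_RC_S$ be a semidualizing $(R,S)$-bimodule. If ${}_RC$ has an ultimately closed projective resolution, then the following statements are equivalent for any $n\ge0$. (1) $\operatorname{pd}_{S^{op}}C\le n$, where $\operatorname{pd}_{S^{op}}C$ is the projective dimension of the right $S$-module $C_S$. (2) $\mathcal{A}_C(S)\text{-}\operatorname{pd}_SN\le n$ for any $N\in\operatorname{Mod} S$.
   Context: All rings are associative with identity. For a ring $T$, $\operatorname{Mod} T$ is the category of left $T$-modules, and $\operatorname{Mod} T^{op}$ is identified with the category of right $T$-modules. All subcategories are full and closed under isomorphisms. Semidualizing: an $(R,S)$-bimodule ${}_RC_S$ is semidualizing if (a1) ${}_RC$ has a projective resolution by finitely generated projective left $R$-modules; (a2) $C_S$ has a projective resolution by finitely generated projective right $S$-modules; (b1) the homothety map $R\to\operatorname{Hom}_{S^{op}}(C,C)$ is an isomorphism; (b2) the homothety map $S\to\operatorname{Hom}_R(C,C)$ is an isomorphism; (c1) $\operatorname{Ext}_R^{i}(C,C)=0$ for all $i\ge1$; (c2) $\operatorname{Ext}_{S^{op}}^{i}(C,C)=0$ for all $i\geq 1$. Auslander class $\mathcal{A}_C(S)$: all $N\in\operatorname{Mod} S$ such that $\operatorname{Tor}^S_i(C,N)=0$ for all $i\ge1$; $\operatorname{Ext}^i_R(C,C\otimes_SN)=0$ for all $i\ge1$; and the map $\mu_N:N\to\operatorname{Hom}_R(C,C\otimes_SN)$, $\mu_N(x)(c)=c\otimes x$, is an isomorphism. For $N\in\operatorname{Mod}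 S$, the Auslander projective dimension $\mathcal{A}_C(S)\text{-}\operatorname{pd}_SN$ is the infimum of the integers $n\ge0$ for which there is an exact sequence $0\to A_n\to\cdots\to A_1\to A_0\to N\to0$ in $\operatorname{Mod} S$ with all $A_i\in\mathcal{A}_C(S)$ (and $\infty$ if there is none). Ultimately closed: a module $X\in\operatorname{Mod} R$ has an ultimately closed projective resolution at $n$ ($n\ge1$) if there is a projective resolution $\cdots\to P_n\xrightarrow{g_n}P_{n-1}\to\cdots\to P_1\xrightarrow{g_1}P_0\xrightarrow{g_0}X\to0$ in $\operatorname{Mod} R$ such that $\operatorname{Im} g_n\cong\bigoplus_jW_j$, where each $W_j$ is isomorphic to a direct summand of some $\operatorname{Im} g_{i_j}$ with $i_j<n$. $X$ has an ultimately closed projective resolution if it has one at some $n\geq 1$. *)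

(* Defs.v *)
From HB Require Import structures.
From mathcomp Require Import all_boot all_order all_algebra.
From mathcomp Require Import generic_quotient.
From mathcomp Require Import all_classical.
Import GRing.Theory.

Set Implicit Arguments.
Unset Strict Implicit.
Unset Printing Implicit Defensive.

Local Open Scope ring_scope.
Local Open Scope quotient_scope.

(* A ring is a [pzRingType], so that the zero ring is allowed, and a right     *)
(* T-module is a left module over the converse ring, i.e. an [lmodType T^c].   *)

Definition onto (A B : Type) (f : A -> B) : Prop := forall y, exists x, f x = y.

Definition exact_at (A : Type) (B D : zmodType) (f : A -> B) (g : B -> D) : Prop :=
  forall y, g y = 0 <-> exists x, f x = y.

Definition mod_isom (T : pzRingType) (M N : lmodType T) : Prop :=
  exists f : {linear M -> N}, bijective f.

Definition projective (T : pzRingType) (P : lmodType T) : Prop :=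
  forall (A B : lmodType T) (p : {linear A -> B}) (f : {linear P -> B}),
    onto p -> exists h : {linear P -> A}, forall x, p (h x) = f x.

Definition fin_gen (T : pzRingType) (M : lmodType T) : Prop :=
  exists (k : nat) (g : 'I_k -> M),
    forall x, exists a : 'I_k -> T, x = \sum_i a i *: g i.

Section Image.
Variables (T : pzRingType) (U V : lmodType T) (f : {linear U -> V}).

Definition im_pred : {pred V} := fun y => `[< exists x, f x = y >].

Lemma im_submod_closed : submod_closed im_pred.
Proof.
split=> [|a u v /asboolP[x <-] /asboolP[y <-]]; apply/asboolP.
  by exists 0; rewrite linear0.
by exists (a *: x + y); rewrite linearP.
Qed.

HB.instance Definition _ := GRing.isSubmodClosed.Build T V im_pred
  (GRing.subsemimod_closed_submod im_submod_closed).

Record image_mod := Image { im_val : V; _ : im_val \in im_pred }.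
HB.instance Definition _ := [isSub for im_val].
HB.instance Definition _ := [Choice of image_mod by <:].
HB.instance Definition _ := [SubChoice_isSubLmodule of image_mod by <:].

End Image.

Section DirectSum.
Variables (T : pzRingType) (J : Type) (W : J -> lmodType T).

Record dsum := DSum {
  dsum_fun :> forall j, W j;
  _ : finite_set [set j | dsum_fun j != 0]%classic }.

HB.instance Definition _ := gen_eqMixin dsum.
HB.instance Definition _ := gen_choiceMixin dsum.

Lemma dsumP (f g : dsum) : (forall j, f j = g j) -> f = g.
Proof.
case: f g => [f hf] [g hg] /= e.
have {}e : f = g by apply: functional_extensionality_dep.
by case: g / e hg => hg; congr DSum; apply: Prop_irrelevance.
Qed.

Lemma dsum_add_fin (f g : dsum) :
  finite_set [set j | f j + g j != 0]%classic.
Proof.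
case: f g => [f hf] [g hg] /=.
have: finite_set ([set j | f j != 0] `|` [set j | g j != 0])%classic.
  by rewrite finite_setU.
apply: sub_finite_set => j /=.
by case: (eqVneq (f j) 0) => [->|]; [rewrite add0r; right|left].
Qed.

Lemma dsum_scale_fin (a : T) (f : dsum) :
  finite_set [set j | a *: f j != 0]%classic.
Proof.
case: f => [f hf] /=; apply: sub_finite_set hf => j /=.
by apply: contra_neq => ->; rewrite scaler0.
Qed.

Lemma dsum_opp_fin (f : dsum) : finite_set [set j | - f j != 0]%classic.
Proof.
by case: f => [f hf] /=; apply: sub_finite_set hf => j /=; rewrite oppr_eq0.
Qed.

Lemma dsum_0_fin : finite_set [set j | (0 : W j) != 0]%classic.
Proof. by apply: sub_finite_set (@finite_set0 J) => j /=; rewrite eqxx. Qed.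

Definition dsum_add f g : dsum := DSum (dsum_add_fin f g).
Definition dsum_opp f : dsum := DSum (dsum_opp_fin f).
Definition dsum_zero : dsum := DSum dsum_0_fin.
Definition dsum_scale a f : dsum := DSum (dsum_scale_fin a f).

Lemma dsum_addA : associative dsum_add.
Proof. by move=> f g h; apply: dsumP => j /=; rewrite addrA. Qed.
Lemma dsum_addC : commutative dsum_add.
Proof. by move=> f g; apply: dsumP => j /=; rewrite addrC. Qed.
Lemma dsum_add0 : left_id dsum_zero dsum_add.
Proof. by move=> f; apply: dsumP => j /=; rewrite add0r. Qed.
Lemma dsum_addN : left_inverse dsum_zero dsum_opp dsum_add.
Proof. by move=> f; apply: dsumP => j /=; rewrite addNr. Qed.

HB.instance Definition _ :=
  GRing.isZmodule.Build dsum dsum_addA dsum_addC dsum_add0 dsum_addN.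

Lemma dsum_scaleA a b f : dsum_scale a (dsum_scale b f) = dsum_scale (a * b) f.
Proof. by apply: dsumP => j /=; rewrite scalerA. Qed.
Lemma dsum_scale1 : left_id 1 dsum_scale.
Proof. by move=> f; apply: dsumP => j /=; rewrite scale1r. Qed.
Lemma dsum_scaleDr : right_distributive dsum_scale +%R.
Proof. by move=> a f g; apply: dsumP => j /=; rewrite scalerDr. Qed.
Lemma dsum_scaleDl f : {morph dsum_scale^~ f : a b / a + b}.
Proof. by move=> a b; apply: dsumP => j /=; rewrite scalerDl. Qed.

HB.instance Definition _ := GRing.Zmodule_isLmodule.Build T dsum
  dsum_scaleA dsum_scale1 dsum_scaleDr dsum_scaleDl.

End DirectSum.

(* The exact sequence ... -> X_2 -> X_1 -> X_0 -> M -> 0, with [bd i] the map  *)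
(* from X_(i+1) to X_i.                                                        *)
Record resolution (T : pzRingType) (M : lmodType T) := Resolution {
  res_term : nat -> lmodType T;
  bd : forall i, {linear res_term i.+1 -> res_term i};
  aug : {linear res_term 0 -> M};
  aug_surj : onto aug;
  aug_exact : exact_at (bd 0) aug;
  bd_exact : forall i, exact_at (bd i.+1) (bd i) }.

Definition proj_resolution (T : pzRingType) (M : lmodType T)
  (P : resolution M) : Prop := forall i, projective (res_term P i).

Definition fg_proj_resolution (T : pzRingType) (M : lmodType T)
  (P : resolution M) : Prop :=
  forall i, projective (res_term P i) /\ fin_gen (res_term P i).

(* An exact sequence 0 -> X_n -> ... -> X_0 -> M -> 0 with all X_i in X is a   *)
(* resolution whose terms beyond X_n are zero.                                 *)
Definition has_resolution_of_length (T : pzRingType) (X : lmodType T -> Prop)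
  (M : lmodType T) (n : nat) : Prop :=
  exists P : resolution M,
    (forall i, (i <= n)%N -> X (res_term P i)) /\
    (forall i, (n < i)%N -> forall x : res_term P i, x = 0).

(* Infimum in nat U {oo} of a set of naturals, [None] standing for oo.         *)
Definition inf_nat (A : nat -> Prop) : option nat :=
  if pselect (exists n, `[< A n >]) is left ex then Some (ex_minn ex) else None.

Definition le_dim (d : option nat) (n : nat) : Prop :=
  if d is Some m then (m <= n)%N else False.

Definition resdim (T : pzRingType) (X : lmodType T -> Prop) (M : lmodType T) :
  option nat := inf_nat (has_resolution_of_length X M).

Definition pd (T : pzRingType) (M : lmodType T) : option nat :=
  resdim (@projective T) M.

(* For P : ... -> P_1 -> P_0 -> X -> 0 with maps g_0 : P_0 -> X and            *)
(* g_(i+1) : P_(i+1) -> P_i, this is Im g_i.                                   *)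
Definition syzygy (T : pzRingType) (M : lmodType T) (P : resolution M)
  (i : nat) : lmodType T :=
  if i is k.+1 then image_mod (bd P k) else image_mod (aug P).

Definition isom_to_summand (T : pzRingType) (W M : lmodType T) : Prop :=
  exists V : lmodType T, mod_isom (W * V)%type M.

Definition ultimately_closed_at (T : pzRingType) (M : lmodType T) (n : nat) :
  Prop :=
  exists P : resolution M, proj_resolution P /\
    exists (J : Type) (W : J -> lmodType T),
      mod_isom (syzygy P n) (dsum W) /\
      forall j, exists i, (i < n)%N /\ isom_to_summand (W j) (syzygy P i).

Definition ultimately_closed (T : pzRingType) (M : lmodType T) : Prop :=
  exists n, (1 <= n)%N /\ ultimately_closed_at M n.

Section Tensor.
Variables (T : pzRingType) (C : lmodType T^c) (N : lmodType T).

Definition balanced (A : zmodType) (f : C -> N -> A) : Prop :=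
  [/\ forall c c' x, f (c + c') x = f c x + f c' x,
      forall c x x', f c (x + x') = f c x + f c x' &
      forall (s : T) c x, f ((s : T^c) *: c) x = f c (s *: x)].

(* C (x) N consists of the formal sums of pairs, two of them being identified  *)
(* when no balanced map separates them; [tensor_univ] below is the universal   *)
(* property.                                                                   *)
Definition tensor_rel (s t : seq (C * N)) : bool :=
  `[< forall (A : zmodType) (f : C -> N -> A), balanced f ->
        \sum_(p <- s) f p.1 p.2 = \sum_(p <- t) f p.1 p.2 >].

Lemma tensor_rel_equiv : equiv_class_of tensor_rel.
Proof.
split=> [s | s t | t s u].
- exact/asboolP.
- by apply/asboolP/asboolP => h A f bf; rewrite h.
- move=> /asboolP h /asboolP k; apply/asboolP => A f bf.
  by rewrite h // k.
Qed.

Canonical tensor_equiv := EquivRelPack tensor_rel_equiv.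
Definition tensor : Type := {eq_quot tensor_equiv}.
HB.instance Definition _ := Choice.on tensor.
HB.instance Definition _ := EqQuotient.on tensor.

Definition tclass (s : seq (C * N)) : tensor := \pi_tensor s.

Lemma tclassE s t : tclass s = tclass t <->
  forall (A : zmodType) (f : C -> N -> A), balanced f ->
    \sum_(p <- s) f p.1 p.2 = \sum_(p <- t) f p.1 p.2.
Proof.
split=> [/eqquotP /asboolP // | h].
by apply/eqquotP/asboolP.
Qed.

Lemma tclass_repr (t : tensor) : tclass (repr t) = t.
Proof. exact: reprK. Qed.

Definition tensor_lift (A : zmodType) (f : C -> N -> A) (t : tensor) : A :=
  \sum_(p <- repr t) f p.1 p.2.

Lemma tensor_liftE (A : zmodType) (f : C -> N -> A) (bf : balanced f) s :
  tensor_lift f (tclass s) = \sum_(p <- s) f p.1 p.2.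
Proof. by move/tclassE: (tclass_repr (tclass s)); apply. Qed.

Definition tensor_zero := tclass [::].
Definition tensor_add (t u : tensor) := tclass (repr t ++ repr u).
Definition tensor_opp (t : tensor) := tclass [seq (- p.1, p.2) | p <- repr t].

Lemma balancedN (A : zmodType) (f : C -> N -> A) c x :
  balanced f -> f (- c) x = - f c x.
Proof.
case=> fD _ _; have f0 : f 0 x = 0.
  by apply: (addrI (f 0 x)); rewrite -fD !addr0.
by apply/eqP; rewrite -addr_eq0 -fD addNr f0.
Qed.

Lemma tclass_add s t : tensor_add (tclass s) (tclass t) = tclass (s ++ t).
Proof.
apply/tclassE => A f bf; rewrite !big_cat.
by congr (_ + _); apply: tensor_liftE.
Qed.

Lemma tclass_opp s : tensor_opp (tclass s) = tclass [seq (- p.1, p.2) | p <- s].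
Proof.
apply/tclassE => A f bf; rewrite !big_map /=.
under eq_bigr do rewrite balancedN //.
under [RHS]eq_bigr do rewrite balancedN //.
by rewrite !sumrN; congr (- _); apply: tensor_liftE.
Qed.

Lemma tensor_addA : associative tensor_add.
Proof.
move=> t u v; rewrite -(tclass_repr t) -(tclass_repr u) -(tclass_repr v).
by rewrite !tclass_add catA.
Qed.

Lemma tensor_addC : commutative tensor_add.
Proof.
move=> t u; rewrite -(tclass_repr t) -(tclass_repr u) !tclass_add.
by apply/tclassE => A f bf; rewrite !big_cat /= addrC.
Qed.

Lemma tensor_add0 : left_id tensor_zero tensor_add.
Proof. by move=> t; rewrite -(tclass_repr t) tclass_add. Qed.

Lemma tensor_addN : left_inverse tensor_zero tensor_opp tensor_add.
Proof.
move=> t; rewrite -(tclass_repr t) tclass_opp tclass_add.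
apply/tclassE => A f bf; rewrite big_cat big_map big_nil /=.
by under eq_bigr do rewrite balancedN //; rewrite sumrN addNr.
Qed.

HB.instance Definition _ :=
  GRing.isZmodule.Build tensor tensor_addA tensor_addC tensor_add0 tensor_addN.

Definition tens (c : C) (x : N) : tensor := tclass [:: (c, x)].

Lemma tens_balanced : balanced tens.
Proof.
split=> [c c' x | c x x' | s c x]; rewrite /tens.
- rewrite [RHS]tclass_add; apply/tclassE => A f [fD _ _].
  by rewrite !big_cons !big_nil !addr0 fD.
- rewrite [RHS]tclass_add; apply/tclassE => A f [_ fD _].
  by rewrite !big_cons !big_nil !addr0 fD.
- by apply/tclassE => A f [_ _ fZ]; rewrite !big_cons !big_nil !addr0 fZ.
Qed.

Lemma tclass_sum s : tclass s = \sum_(p <- s) tens p.1 p.2.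
Proof.
elim: s => [|[c x] s ih]; first by rewrite big_nil.
by rewrite big_cons -ih [RHS]tclass_add.
Qed.

Lemma tensor_ind (Q : tensor -> Prop) :
  Q 0 -> (forall c x t, Q t -> Q (tens c x + t)) -> forall t, Q t.
Proof.
move=> Q0 QD t; rewrite -(tclass_repr t) tclass_sum.
by elim: (repr t) => [|p s ih]; rewrite ?big_nil // big_cons; apply: QD.
Qed.

Lemma tensor_lift_add (A : zmodType) (f : C -> N -> A) : balanced f ->
  {morph tensor_lift f : t u / t + u}.
Proof.
move=> bf t u; rewrite -(tclass_repr t) -(tclass_repr u) [_ + _]tclass_add.
by rewrite !tensor_liftE // big_cat.
Qed.

Lemma tensor_lift_tens (A : zmodType) (f : C -> N -> A) c x : balanced f ->
  tensor_lift f (tens c x) = f c x.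
Proof. by move=> bf; rewrite tensor_liftE // big_cons big_nil addr0. Qed.

Lemma tensor_univ (A : zmodType) (f : C -> N -> A) : balanced f ->
  exists! g : tensor -> A,
    {morph g : t u / t + u} /\ forall c x, g (tens c x) = f c x.
Proof.
move=> bf; exists (tensor_lift f); split.
  by split=> [|c x]; [exact: tensor_lift_add | exact: tensor_lift_tens].
move=> g [gD ge]; apply/funext; elim/tensor_ind => [|c x t ih].
  have h0 : tensor_lift f 0 = 0 by rewrite tensor_liftE // big_nil.
  by rewrite h0; apply: (addrI (g 0)); rewrite addr0 -gD addr0.
by rewrite tensor_lift_add // gD ih tensor_lift_tens // ge.
Qed.

End Tensor.

Definition tensor_map (T : pzRingType) (C : lmodType T^c) (N N' : lmodType T)
  (g : {linear N -> N'}) : tensor C N -> tensor C N' :=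
  tensor_lift (fun c x => tens c (g x)).
Arguments tensor_map {T} C {N N'} g.

Definition Hom_cohomology_eq0 (T : pzRingType) (M N : lmodType T)
  (P : resolution M) (i : nat) : Prop :=
  match i with
  | 0 => forall f : {linear res_term P 0 -> N},
      (forall x, f (bd P 0 x) = 0) -> forall x, f x = 0
  | k.+1 => forall f : {linear res_term P k.+1 -> N},
      (forall x, f (bd P k.+1 x) = 0) ->
      exists h : {linear res_term P k -> N}, forall x, f x = h (bd P k x)
  end.

Definition tensor_homology_eq0 (T : pzRingType) (C : lmodType T^c)
  (M : lmodType T) (P : resolution M) (i : nat) : Prop :=
  if i is k.+1
  then exact_at (tensor_map C (bd P k.+1)) (tensor_map C (bd P k))
  else onto (tensor_map C (bd P 0)).

(* Ext^i(M, N) and Tor_i(C, N) are the (co)homology of Hom(P, N) and of        *)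
(* C (x) P for a projective resolution P of M, resp. of N; they do not depend  *)
(* on P up to isomorphism.                                                     *)
Definition Ext_eq0 (T : pzRingType) (i : nat) (M N : lmodType T) : Prop :=
  forall P : resolution M, proj_resolution P -> Hom_cohomology_eq0 N P i.

Definition Tor_eq0 (T : pzRingType) (i : nat) (C : lmodType T^c)
  (N : lmodType T) : Prop :=
  forall P : resolution N, proj_resolution P -> tensor_homology_eq0 C P i.

Record bimodule (R S : pzRingType) := Bimodule {
  lmod : lmodType R;
  ract : lmod -> S -> lmod;
  ractA : forall c s t, ract (ract c s) t = ract c (s * t);
  ract1 : forall c, ract c 1 = c;
  ractDl : forall c c' s, ract (c + c') s = ract c s + ract c' s;
  ractDr : forall c s t, ract c (s + t) = ract c s + ract c t;
  ractZ : forall (r : R) c s, ract (r *: c) s = r *: ract c s }.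

Section Bimodule.
Variables (R S : pzRingType) (C : bimodule R S).

(* The right S-module C_S needs an alias of the carrier, which already carries *)
(* the structure of the left R-module C.                                       *)
Definition rmod : Type := lmod C.
HB.instance Definition _ := GRing.Zmodule.copy rmod (lmod C).

Definition rmod_scale (s : S^c) (c : rmod) : rmod := ract (c : lmod C) (s : S).

Lemma rmod_scaleA (s t : S^c) c :
  rmod_scale s (rmod_scale t c) = rmod_scale (s * t) c.
Proof. exact: ractA. Qed.
Lemma rmod_scale1 : left_id 1 rmod_scale.
Proof. exact: ract1. Qed.
Lemma rmod_scaleDr : right_distributive rmod_scale +%R.
Proof. by move=> s c c'; exact: ractDl. Qed.
Lemma rmod_scaleDl c : {morph rmod_scale^~ c : s t / s + t}.
Proof. by move=> s t; exact: ractDr. Qed.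

HB.instance Definition _ := GRing.Zmodule_isLmodule.Build S^c rmod
  rmod_scaleA rmod_scale1 rmod_scaleDr rmod_scaleDl.

Definition homothetyl_fun (r : R) (c : rmod) : rmod := r *: (c : lmod C).
Definition homothetyr_fun (s : S) (c : lmod C) : lmod C := ract c s.

Lemma homothetyl_linear r : linear (homothetyl_fun r).
Proof.
move=> s c c'; rewrite /homothetyl_fun.
by rewrite [LHS]scalerDr; congr (_ + _); rewrite -[LHS]ractZ.
Qed.

Lemma homothetyr_linear s : linear (homothetyr_fun s).
Proof. by move=> r c c'; rewrite /homothetyr_fun ractDl ractZ. Qed.

HB.instance Definition _ r :=
  GRing.isLinear.Build S^c rmod rmod *:%R (homothetyl_fun r)
    (homothetyl_linear r).
HB.instance Definition _ s :=
  GRing.isLinear.Build R (lmod C) (lmod C) *:%R (homothetyr_fun s)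
    (homothetyr_linear s).

Definition homothetyl (r : R) : {linear rmod -> rmod} := homothetyl_fun r.
Definition homothetyr (s : S) : {linear lmod C -> lmod C} := homothetyr_fun s.

Definition btensor (N : lmodType S) : Type := tensor rmod N.
HB.instance Definition _ N := GRing.Zmodule.copy (btensor N) (tensor rmod N).

Definition btens (N : lmodType S) (c : lmod C) (x : N) : btensor N :=
  tens (c : rmod) x.

Definition btensor_scale (N : lmodType S) (r : R) : btensor N -> btensor N :=
  tensor_lift (fun (c : rmod) x => btens (r *: (c : lmod C)) x).

Section BTensor.
Variable N : lmodType S.

Lemma btens_scale_balanced (r : R) :
  balanced (fun (c : rmod) (x : N) => btens (r *: (c : lmod C)) x).
Proof.
have [tD tD' tZ] := tens_balanced rmod N.
split=> [c c' x | c x x' | s c x].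
- by rewrite /btens [r *: _]scalerDr tD.
- by rewrite /btens tD'.
- by rewrite /btens -[r *: _]ractZ; exact: tZ.
Qed.

Lemma btensor_scale_tens r c (x : N) :
  btensor_scale r (btens c x) = btens (r *: c) x.
Proof. exact: (tensor_lift_tens _ _ (btens_scale_balanced r)). Qed.

Lemma btensor_scaleDr : right_distributive (@btensor_scale N) +%R.
Proof. by move=> r; exact: (tensor_lift_add (btens_scale_balanced r)). Qed.

Lemma btensor_scale0 r : btensor_scale r (0 : btensor N) = 0.
Proof.
apply: (addrI (btensor_scale r 0)).
by rewrite -btensor_scaleDr !addr0.
Qed.

Lemma btensor_scaleA r s (t : btensor N) :
  btensor_scale r (btensor_scale s t) = btensor_scale (r * s) t.
Proof.
move: t; apply: tensor_ind => [|c x t ih]; first by rewrite !btensor_scale0.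
rewrite !btensor_scaleDr ih; congr (_ + _).
by rewrite !btensor_scale_tens scalerA.
Qed.

Lemma btensor_scale1 : left_id 1 (@btensor_scale N).
Proof.
apply: tensor_ind => [|c x t ih]; first by rewrite !btensor_scale0.
rewrite !btensor_scaleDr ih; congr (_ + _).
by rewrite !btensor_scale_tens scale1r.
Qed.

Lemma btensor_scaleDl (t : btensor N) :
  {morph (@btensor_scale N)^~ t : r s / r + s}.
Proof.
move=> r s; move: t; apply: tensor_ind => [|c x t ih].
  by rewrite !btensor_scale0 addr0.
rewrite !btensor_scaleDr ih addrACA; congr (_ + _).
rewrite !btensor_scale_tens scalerDl.
by have [tD _ _] := tens_balanced rmod N; exact: tD.
Qed.

HB.instance Definition _ := GRing.Zmodule_isLmodule.Build R (btensor N)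
  btensor_scaleA btensor_scale1 btensor_scaleDr btensor_scaleDl.

Definition mu_fun (x : N) (c : lmod C) : btensor N := btens c x.

Lemma mu_linear x : linear (mu_fun x).
Proof.
move=> r c c'; rewrite /mu_fun.
have [tD _ _] := tens_balanced rmod N.
rewrite [LHS]tD; congr (_ + _); exact/esym/btensor_scale_tens.
Qed.

HB.instance Definition _ x :=
  GRing.isLinear.Build R (lmod C) (btensor N) *:%R (mu_fun x) (mu_linear x).

Definition mu (x : N) : {linear lmod C -> btensor N} := mu_fun x.

End BTensor.

Record semidualizing : Prop := Semidualizing {
  sd_a1 : exists P : resolution (lmod C), fg_proj_resolution P;
  sd_a2 : exists P : resolution (rmod : lmodType S^c), fg_proj_resolution P;
  sd_b1 : bijective homothetyl;
  sd_b2 : bijective homothetyr;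
  sd_c1 : forall i, (1 <= i)%N -> Ext_eq0 i (lmod C) (lmod C);
  sd_c2 : forall i, (1 <= i)%N -> Ext_eq0 i (rmod : lmodType S^c) rmod }.

Record auslander_class (N : lmodType S) : Prop := AuslanderClass {
  ac_tor : forall i, (1 <= i)%N -> Tor_eq0 i rmod N;
  ac_ext : forall i, (1 <= i)%N -> Ext_eq0 i (lmod C) (btensor N);
  ac_mu : bijective (@mu N) }.

Definition auslander_pd (N : lmodType S) : option nat :=
  resdim auslander_class N.

End Bimodule.

(* Main.v *)
From HB Require Import structures.
Require Import Defs.
From mathcomp Require Import all_boot all_order all_algebra.
From mathcomp Require Import generic_quotient ring_quotient.
From mathcomp Require Import all_classical.
Import GRing.Theory.

Set Implicit Arguments.
Unset Strict Implicit.
Unset Printing Implicit Defensive.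

Local Open Scope ring_scope.
Local Open Scope quotient_scope.

(* Write TT for the left S-modules K with Tor_i(C, K) = 0 for all i >= 1.      *)
(* The point is that TT is the Auslander class. For Q projective, C (x) Q is a *)
(* retract of a direct sum of copies of C, so Ext^i(C, C (x) Q) = 0 and mu_Q   *)
(* is bijective. If K is an (i+2)-nd syzygy of a module of TT, left exactness  *)
(* of Hom(C, -) and dimension shifting give Ext^i(C, C (x) K) = 0; the         *)
(* ultimately closed resolution propagates a finite range of such vanishing to *)
(* all i, and dimension shifting back along C (x) Q_i reaches every K in TT,   *)
(* for which mu_K is then bijective too. Hence A_C(S)-pd N <= n iff            *)
(* Tor_i(C, N) = 0 for i > n, and this holds for all N iff the n-th syzygy of  *)
(* C_S, which is finitely presented, is flat, that is projective.              *)

(** Both conditions are equivalent to the vanishing of Tor_i(C, N) for all i > n and all N. A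
    projective resolution of C_S of length n gives this vanishing ([tor0_pd]). Conversely, by (a2)
    the n-th syzygy of C_S is finitely presented, the vanishing makes it flat, and a finitely
    presented flat module is projective ([projective_length_of_tor0]). On the other side, once
    A_C(S) is identified with the [tor_acyclic] modules ([auslander_class_acyclic]), a resolution of
    N of length n by that class kills Tor above n ([tor0_length]), while vanishing above n makes the
    n-th free syzygy of N a member of the class ([auslander_length]).

    The core is that Tor-acyclicity of K alone forces mu_K to be bijective and Ext^i(C, C (x) K) =
    0. For K projective this reduces, coordinate by coordinate, to the homothety and Ext conditions
    on C, because C has a resolution by finitely generated projectives ([fin_gen_bcoord]). In 0 -> K
    -> Q -> N -> 0 with Q projective and N Tor-acyclic, each passage to a syzygy gains something: mu
    becomes injective, then onto, then Ext^1 vanishes, then one further Ext per step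
    ([ext0_btensor_acyclic_syzygy]). An ultimately closed resolution makes the vanishing of finitely
    many Ext groups imply that of all ([ultimately_closed_ext0]), so deep syzygies have no Ext at
    all, and dimension shifting carries this back to every Tor-acyclic module
    ([ext0_btensor_acyclic]).

    Vanishing of Ext and Tor is expressed by the recursive predicates [ext0] and [tor0], which
    quantify over all short exact sequences with projective middle term. Dimension shifting is then
    built in, and only the needed fragments of the long exact sequences are proved. *)

Definition linear_of (T : pzRingType) (U V : lmodType T) (f : U -> V)
    (f_lin : linear f) : {linear U -> V} :=
  HB.pack f (GRing.isLinear.Build T U V *:%R f f_lin).

(** The homothety and mu conditions assert bijectivity onto a type of bundled linear maps, so
    pointwise equal bundles have to be identified; their proof components agree by proof
    irrelevance. *)
Lemma linear_eq (T : pzRingType) (U V : lmodType T) (f g : {linear U -> V}) :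
  f =1 g -> f = g.
Proof.
move=> fg; case: f g fg => f [a b] [g [c d]] /= fg.
have e : f = g by apply/funext.
case: g / e c d fg => c d _; congr (GRing.Linear.Pack _).
case: a c => a [c]; case: b d => b [d].
by rewrite (Prop_irrelevance a c) (Prop_irrelevance b d).
Qed.

Lemma inj_onto_bijective (A B : Type) (f : A -> B) : injective f -> onto f -> bijective f.
Proof.
by move=> fi /choice[g gK]; exists g => // x; apply: fi; rewrite gK.
Qed.

Definition additive_of (U V : zmodType) (f : U -> V) (fB : {morph f : x y / x - y}) :
  {additive U -> V} := HB.pack f (GRing.isZmodMorphism.Build U V f fB).

Lemma morphD_morphB (U V : zmodType) (f : U -> V) :
  {morph f : x y / x + y} -> {morph f : x y / x - y}.
Proof.
move=> fD x y; have f0 : f 0 = 0 by apply: (addrI (f 0)); rewrite -fD !addr0.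
rewrite fD; congr (_ + _); apply/eqP.
by rewrite -addr_eq0 -fD addNr f0.
Qed.

Section AdditiveCokernel.
Variables (U V : zmodType) (f : {additive U -> V}).

Definition additive_image : {pred V} := fun y => `[< exists x, f x = y >].

Lemma additive_image_zmod_closed : zmod_closed additive_image.
Proof.
split=> [|y z /asboolP[a <-] /asboolP[b <-]]; apply/asboolP.
  by exists 0; rewrite raddf0.
by exists (a - b); rewrite raddfB.
Qed.

HB.instance Definition _ :=
  GRing.isZmodClosed.Build V additive_image additive_image_zmod_closed.

(** The cokernel is the test group in the proof that tensor products are right exact. *)
Lemma additive_coker :
  exists (D : zmodType) (q : {additive V -> D}), onto q /\ exact_at f q.
Proof.
pose D := Quotient.quot additive_image.
exists D, \pi_D; split=> [y|y]; first by exists (repr y); exact: reprK.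
have -> : (\pi_D y = 0) <-> (y \in additive_image).
  have -> : (0 : D) = \pi_D 0 by rewrite raddf0.
  rewrite -[in X in _ <-> X](subr0 y) Quotient.idealrBE.
  by split=> /eqP.
by split=> /asboolP.
Qed.

End AdditiveCokernel.

Section LinearCokernel.
Variables (T : pzRingType) (U V : lmodType T) (f : {linear U -> V}).

Definition coker : Type := Quotient.quot (im_pred f).
HB.instance Definition _ := GRing.Zmodule.on coker.

Definition coker_proj (x : V) : coker := \pi_(Quotient.quot (im_pred f)) x.

Lemma coker_projE x y : (coker_proj x = coker_proj y) <-> exists u, f u = x - y.
Proof.
split=> [/eqP|h].
  by rewrite /coker_proj -Quotient.idealrBE => /asboolP.
by apply/eqP; rewrite /coker_proj -Quotient.idealrBE; apply/asboolP.
Qed.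

Lemma coker_projD : {morph coker_proj : x y / x + y}.
Proof. exact: (raddfD \pi_(Quotient.quot (im_pred f))). Qed.

Definition coker_scale (a : T) (x : coker) : coker :=
  coker_proj (a *: repr (x : Quotient.quot (im_pred f))).

Lemma coker_projK (x : coker) :
  coker_proj (repr (x : Quotient.quot (im_pred f))) = x.
Proof. exact: reprK. Qed.

Lemma coker_projZ a x : coker_scale a (coker_proj x) = coker_proj (a *: x).
Proof.
apply/coker_projE; rewrite -scalerBr.
have /coker_projE[u uE] := coker_projK (coker_proj x).
by exists (a *: u); rewrite linearZ uE.
Qed.

Lemma coker_scaleA a b x : coker_scale a (coker_scale b x) = coker_scale (a * b) x.
Proof. by rewrite -(coker_projK x) !coker_projZ scalerA. Qed.
Lemma coker_scale1 : left_id 1 coker_scale.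
Proof. by move=> x; rewrite -(coker_projK x) coker_projZ scale1r. Qed.
Lemma coker_scaleDr : right_distributive coker_scale +%R.
Proof.
move=> a x y; rewrite -(coker_projK x) -(coker_projK y).
by rewrite -coker_projD !coker_projZ scalerDr coker_projD.
Qed.
Lemma coker_scaleDl x : {morph coker_scale^~ x : a b / a + b}.
Proof.
by move=> a b; rewrite -(coker_projK x) !coker_projZ scalerDl coker_projD.
Qed.

HB.instance Definition _ := GRing.Zmodule_isLmodule.Build T coker
  coker_scaleA coker_scale1 coker_scaleDr coker_scaleDl.

Lemma coker_proj_linear : linear coker_proj.
Proof. by move=> a x y; rewrite coker_projD -coker_projZ. Qed.

Lemma linear_coker :
  exists (D : lmodType T) (q : {linear V -> D}), onto q /\ exact_at f q.
Proof.
exists coker, (linear_of coker_proj_linear); split=> [y|y] /=.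
  by exists (repr (y : Quotient.quot (im_pred f))); rewrite coker_projK.
have <- : coker_proj 0 = 0 by apply: (addrI (coker_proj 0)); rewrite -coker_projD !addr0.
by rewrite coker_projE subr0.
Qed.

End LinearCokernel.

Section Kernel.
Variables (T : pzRingType) (U V : lmodType T) (f : {linear U -> V}).

Definition ker_pred : {pred U} := fun x => f x == 0.

Lemma ker_submod_closed : submod_closed ker_pred.
Proof.
split=> [|a u v /eqP fu /eqP fv]; apply/eqP; first exact: linear0.
by rewrite linearP fu fv scaler0 addr0.
Qed.

HB.instance Definition _ := GRing.isSubmodClosed.Build T U ker_pred
  (GRing.subsemimod_closed_submod ker_submod_closed).

Record ker_mod := Ker { ker_val : U; _ : ker_val \in ker_pred }.
HB.instance Definition _ := [isSub for ker_val].
HB.instance Definition _ := [Choice of ker_mod by <:].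
HB.instance Definition _ := [SubChoice_isSubLmodule of ker_mod by <:].

Lemma ker_val_linear : linear ker_val.
Proof. by move=> a x y; exact: (linearP (val : ker_mod -> U)). Qed.

Definition ker_incl : {linear ker_mod -> U} := linear_of ker_val_linear.

End Kernel.

Section ShortExact.
Variable T : pzRingType.
Implicit Types A B D U V X Y : lmodType T.

Definition ses A B D (i : {linear A -> B}) (p : {linear B -> D}) : Prop :=
  [/\ injective i, onto p & exact_at i p].

Lemma ses_ker U V (f : {linear U -> V}) : onto f -> ses (ker_incl f) f.
Proof.
move=> fo; split=> // [x y /val_inj // | y]; split=> [fy|[x <-]].
  by exists (Ker (introT eqP fy)).
by case: x => x /= /eqP.
Qed.

Lemma linear_inj U V (f : {linear U -> V}) :
  (forall x, f x = 0 -> x = 0) -> injective f.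
Proof.
move=> f0 x y fxy; apply/eqP; rewrite -subr_eq0; apply/eqP/f0.
by rewrite linearB fxy subrr.
Qed.

Lemma lift_through_inj A B X (i : {linear A -> B}) (f : {linear X -> B}) :
  injective i -> (forall x, exists a, i a = f x) ->
  exists g : {linear X -> A}, forall x, i (g x) = f x.
Proof.
move=> ii /choice[g gE].
suff gl : linear g by exists (linear_of gl).
by move=> a x y; apply: ii; rewrite linearP !gE linearP.
Qed.

Lemma factor_through_onto B D Y (p : {linear B -> D}) (f : {linear B -> Y}) :
  onto p -> (forall x, p x = 0 -> f x = 0) ->
  exists g : {linear D -> Y}, forall x, g (p x) = f x.
Proof.
move=> /choice[s sE] h.
have hE x y : p x = p y -> f x = f y.
  move=> e; apply/eqP; rewrite -subr_eq0 -linearB; apply/eqP/h.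
  by rewrite linearB e subrr.
suff gl : linear (f \o s) by exists (linear_of gl) => x /=; apply: hE; rewrite sE.
by move=> a x y /=; rewrite -linearP; apply: hE; rewrite linearP !sE.
Qed.

Lemma ses_lift A B D X (i : {linear A -> B}) (p : {linear B -> D})
    (f : {linear X -> B}) :
  ses i p -> (forall x, p (f x) = 0) ->
  exists g : {linear X -> A}, forall x, i (g x) = f x.
Proof. by case=> ii _ ex pf; apply: lift_through_inj => // x; apply/ex. Qed.

Lemma ses_comp0 A B D (i : {linear A -> B}) (p : {linear B -> D}) x :
  ses i p -> p (i x) = 0.
Proof. by case=> _ _ ex; apply/ex; exists x. Qed.

Lemma linear_comp A B D (f : {linear A -> B}) (g : {linear B -> D}) :
  exists h : {linear A -> D}, forall x, h x = g (f x).
Proof. by exists (g \o f). Qed.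

Lemma linear_add A B (f g : {linear A -> B}) :
  exists h : {linear A -> B}, forall x, h x = f x + g x.
Proof. by exists (f \+ g). Qed.

Lemma linear_sub A B (f g : {linear A -> B}) :
  exists h : {linear A -> B}, forall x, h x = f x - g x.
Proof. by exists (f \- g). Qed.

End ShortExact.

(** * Direct sums: universal property, projectivity, exactness *)

Section DirectSumTheory.
Variables (T : pzRingType) (J : Type) (W : J -> lmodType T).
Implicit Types (f g : dsum W) (N : lmodType T).

Local Notation Jc := {classic J}.

Lemma dsum_supp f : exists s : seq Jc, uniq s /\ forall j : Jc, j \notin s -> f j = 0.
Proof.
have : finite_set [set j : Jc | f j != 0]%classic by case: f.
move=> /finite_seqP[s sE].
exists (undup s); split; first exact: undup_uniq.
move=> j; rewrite mem_undup => js; apply/eqP/negPn/negP => fj.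
have : [set j : Jc | dsum_fun f j != 0]%classic j by [].
by rewrite sE /= (negPf js).
Qed.

Definition dsum_lift_fun N (h : forall j, {linear W j -> N}) f : N :=
  \sum_(j \in [set: Jc]%classic) h j (f j).

(** Any duplicate-free list containing the support computes the sum, so one list can serve several
    elements at once. *)
Lemma dsum_lift_seq N (h : forall j, {linear W j -> N}) f (s : seq Jc) :
  uniq s -> (forall j : Jc, j \notin s -> f j = 0) ->
  dsum_lift_fun h f = \sum_(j <- s) h j (f j).
Proof.
move=> us f0; rewrite (@bigfs _ _ _ Jc s predT) //=.
  by apply: eq_fsbigl; apply/seteqP; split.
by move=> j _ /f0 ->; rewrite linear0.
Qed.

Lemma dsum_lift_linear N (h : forall j, {linear W j -> N}) :
  linear (dsum_lift_fun h).
Proof.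
move=> a f g; have [s [_ sf]] := dsum_supp f; have [t [_ tg]] := dsum_supp g.
pose r := undup (s ++ t); have ur : uniq r by apply: undup_uniq.
have rf j : j \notin r -> f j = 0.
  by rewrite mem_undup mem_cat negb_or => /andP[/sf].
have rg j : j \notin r -> g j = 0.
  by rewrite mem_undup mem_cat negb_or => /andP[_ /tg].
have rfg j : j \notin r -> (a *: f + g) j = 0.
  by move=> jr /=; rewrite rf // rg // scaler0 addr0.
rewrite !(dsum_lift_seq _ ur) // scaler_sumr -big_split.
by apply: eq_bigr => j _; exact: (linearP (h j)).
Qed.

Definition dsum_lift N (h : forall j, {linear W j -> N}) : {linear dsum W -> N} :=
  linear_of (dsum_lift_linear h).

(** Summands at different indices have different types, so [x] is transported along a proof of
    [j = k]; proof irrelevance makes the choice of that proof immaterial. *)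
Definition dsum_single_fun (j : J) (x : W j) (k : J) : W k :=
  if pselect (j = k) is left e then eq_rect j W x k e else 0.

Lemma dsum_single_same j (x : W j) : dsum_single_fun x j = x.
Proof.
rewrite /dsum_single_fun; case: pselect => // e.
by rewrite (Prop_irrelevance e erefl).
Qed.

Lemma dsum_single_neq j (x : W j) k : j <> k -> dsum_single_fun x k = 0.
Proof. by rewrite /dsum_single_fun; case: pselect. Qed.

Lemma dsum_single_fin j (x : W j) :
  finite_set [set k | dsum_single_fun x k != 0]%classic.
Proof.
apply: sub_finite_set (finite_set1 j) => k /=.
by case: (pselect (j = k)) => // /dsum_single_neq ->; rewrite eqxx.
Qed.

Definition dsum_single j (x : W j) : dsum W := DSum (dsum_single_fin x).

Lemma dsum_single_linear j : linear (@dsum_single j).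
Proof.
move=> a x y; apply: dsumP => k /=.
case: (pselect (j = k)) => [<-|jk]; first by rewrite !dsum_single_same.
by rewrite !dsum_single_neq // scaler0 addr0.
Qed.

Definition dsum_in j : {linear W j -> dsum W} := linear_of (@dsum_single_linear j).

Lemma dsum_sumE (I : Type) (r : seq I) (F : I -> dsum W) j :
  (\sum_(i <- r) F i) j = \sum_(i <- r) F i j.
Proof. by elim: r => [|i r ih]; rewrite ?big_nil // !big_cons -ih. Qed.

Lemma dsum_decomp f (s : seq Jc) :
  uniq s -> (forall j : Jc, j \notin s -> f j = 0) ->
  f = \sum_(j <- s) dsum_in j (f j).
Proof.
move=> us f0; apply: dsumP => k; rewrite dsum_sumE /=.
have [ks|ks] := boolP ((k : Jc) \in s).
  rewrite (bigD1_seq (k : Jc)) //= dsum_single_same big1_seq ?addr0 // => j.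
  by case/andP=> /eqP jk _; rewrite dsum_single_neq.
rewrite f0 // big1_seq // => j /andP[_ js].
by rewrite dsum_single_neq // => jk; move: ks; rewrite -jk js.
Qed.

Lemma dsum_lift_in N (h : forall j, {linear W j -> N}) j x :
  dsum_lift h (dsum_in j x) = h j x.
Proof.
rewrite /= (@dsum_lift_seq _ _ _ [:: j : Jc]) //=.
  by rewrite big_cons big_nil addr0 dsum_single_same.
by move=> k; rewrite inE => /eqP jk; rewrite dsum_single_neq // => e; apply: jk.
Qed.

Lemma dsum_ext N (h h' : {linear dsum W -> N}) :
  (forall j x, h (dsum_in j x) = h' (dsum_in j x)) -> forall f, h f = h' f.
Proof.
move=> hh f; have [s [us sf]] := dsum_supp f.
by rewrite (dsum_decomp us sf) !linear_sum; apply: eq_bigr => j _; apply: hh.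
Qed.

Lemma dsum_proj_linear j : linear (fun f : dsum W => f j).
Proof. by []. Qed.

Definition dsum_proj j : {linear dsum W -> W j} := linear_of (dsum_proj_linear j).

Lemma projective_dsum : (forall j, projective (W j)) -> projective (dsum W).
Proof.
move=> Wp A B p f po.
have h_ex j : exists h : {linear W j -> A}, forall x, p (h x) = f (dsum_in j x).
  by have [g gE] := linear_comp (dsum_in j) f; have [h hE] := Wp j A B p g po;
     exists h => x; rewrite hE gE.
pose h j := projT1 (cid (h_ex j)).
have hE j x : p (h j x) = f (dsum_in j x) by rewrite /h; case: cid.
exists (dsum_lift h) => x; have [g gE] := linear_comp (dsum_lift h) p.
by rewrite -gE; apply: dsum_ext => j y; rewrite gE dsum_lift_in.
Qed.

End DirectSumTheory.

Section DirectSumMap.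
Variables (T : pzRingType) (J : Type) (U V : J -> lmodType T).
Variable h : forall j, {linear U j -> V j}.

Lemma dsum_map_fin (f : dsum U) : finite_set [set j | h j (f j) != 0]%classic.
Proof.
case: f => f f_fin /=; apply: (sub_finite_set _ f_fin) => j /=.
by apply: contra_neq => ->; rewrite linear0.
Qed.

Lemma dsum_map_linear : linear (fun f : dsum U => DSum (dsum_map_fin f)).
Proof. by move=> a f g; apply: dsumP => j /=; rewrite linearP. Qed.

Definition dsum_map : {linear dsum U -> dsum V} := linear_of dsum_map_linear.

End DirectSumMap.

Lemma ses_dsum (T : pzRingType) (J : Type) (A B D : J -> lmodType T)
    (i : forall j, {linear A j -> B j}) (p : forall j, {linear B j -> D j}) :
  (forall j, ses (i j) (p j)) -> ses (dsum_map i) (dsum_map p).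
Proof.
move=> h.
have lift_ex (X Y : J -> lmodType T) (g : forall j, {linear X j -> Y j}) (y : dsum Y) :
    (forall j, exists x, g j x = y j) -> exists x, dsum_map g x = y.
  move=> yx.
  (* Choosing the preimage 0 wherever [y j] is 0 keeps the support finite. *)
  have x_ex j : exists x, g j x = y j /\ (y j = 0 -> x = 0).
    have [->|/eqP yj] := eqVneq (y j) 0; first by exists 0; rewrite linear0.
    by have [x xE] := yx j; exists x; split=> // /yj.
  pose x j := projT1 (cid (x_ex j)).
  have xE j : g j (x j) = y j /\ (y j = 0 -> x j = 0) by rewrite /x; case: cid.
  have xf : finite_set [set j | x j != 0]%classic.
    case: (y) xE => y' y_fin /= xE; apply: (sub_finite_set _ y_fin) => j /=.
    by apply: contra_neq => yj; apply: (xE j).2.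
  by exists (DSum xf); apply: dsumP => j /=; case: (xE j).
split=> [f g e|y|y].
- apply: dsumP => j; have [ii _ _] := h j.
  by apply: ii; move: (congr1 (@dsum_fun _ _ _ ^~ j) e).
- by apply: lift_ex => j; have [_ po _] := h j.
- split=> [py|[x <-]].
    apply: lift_ex => j; have [_ _ ex] := h j; apply/ex.
    exact: (congr1 (@dsum_fun _ _ _ ^~ j) py).
  by apply: dsumP => j /=; exact: ses_comp0 (h j).
Qed.

(** * Free covers and dual bases of projective modules *)

Section FreeCover.
Variable T : pzRingType.
Implicit Types M P Q : lmodType T.

Lemma regular_smul_linear M (x : M) : linear (fun a : T^o => (a : T) *: x).
Proof. by move=> a b c; rewrite scalerDl -scalerA. Qed.

Definition regular_smul M (x : M) : {linear T^o -> M} :=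
  linear_of (regular_smul_linear x).

Lemma projective_regular : projective (T^o : lmodType T).
Proof.
move=> A B p f po; have [x xE] := po (f 1).
exists (regular_smul x) => a /=.
by rewrite linearZ xE -linearZ; congr (f _); exact: mulr1.
Qed.

Definition free_cover M : lmodType T := dsum (fun _ : M => T^o : lmodType T).

Definition free_cover_map M : {linear free_cover M -> M} :=
  dsum_lift (fun x : M => regular_smul x).

Lemma projective_free_cover M : projective (free_cover M).
Proof. by apply: projective_dsum => _; exact: projective_regular. Qed.

Lemma free_cover_map_onto M : onto (free_cover_map M).
Proof.
move=> x; exists (dsum_in (fun _ : M => T^o) x 1).
by rewrite /free_cover_map dsum_lift_in /= scale1r.
Qed.

Definition free_syzygy M : lmodType T := ker_mod (free_cover_map M).

Lemma ses_free_cover M : ses (ker_incl (free_cover_map M)) (free_cover_map M).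
Proof. exact/ses_ker/free_cover_map_onto. Qed.

(** A dual basis whose generating family is all of [Q], indexed by itself. Every larger list is
    allowed in the expansion, so that the lists of several elements can be merged. *)
Definition dual_basis Q (phi : Q -> {linear Q -> T^o}) : Prop :=
  forall x, exists s : seq {classic Q},
    (forall q : {classic Q}, q \notin s -> phi q x = 0) /\
    forall r : seq {classic Q}, uniq r -> {subset s <= r} ->
      x = \sum_(q <- r) (phi q x : T) *: q.

Lemma projective_dual_basis Q : projective Q -> exists phi, @dual_basis Q phi.
Proof.
move=> Qp; have [sg sgE] :=
  Qp _ _ (free_cover_map Q) idfun (@free_cover_map_onto Q).
have /choice[phi phiE] (q : Q) :
    exists phi : {linear Q -> T^o}, forall x, phi x = sg x q.
  by have [g gE] := linear_comp sg (dsum_proj (fun _ : Q => T^o) q); exists g.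
exists phi => x; have [s [us sx]] := dsum_supp (sg x).
have {}sx (q : {classic Q}) : q \notin s -> phi q x = 0 by rewrite phiE; exact: sx.
exists s; split=> // r ur sr; rewrite -[LHS](sgE x) /= /free_cover_map.
rewrite (@dsum_lift_seq _ _ _ _ _ _ r) //.
  by apply: eq_bigr => q _; rewrite phiE.
by move=> q qr; rewrite -phiE; apply: sx; apply: contra qr; exact: sr.
Qed.

Lemma retract_projective P Q (i : {linear P -> Q}) (r : {linear Q -> P}) :
  (forall x, r (i x) = x) -> projective Q -> projective P.
Proof.
move=> ri Qp A B p f po; have [g gE] := linear_comp r f.
have [h hE] := Qp A B p g po; have [k kE] := linear_comp i h.
by exists k => x; rewrite kE hE gE ri.
Qed.

End FreeCover.

Lemma exact_precomp (A' A : Type) (B D : zmodType) (r : A' -> A) (f : A -> B)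
    (g : B -> D) :
  onto r -> exact_at f g -> exact_at (f \o r) g.
Proof.
move=> ro ex y; rewrite ex; split=> [[x <-]|[x <-]]; last by exists (r x).
by have [z <-] := ro x; exists z.
Qed.

Lemma exact_postcomp (A : Type) (B D E : zmodType) (f : A -> B) (g : B -> D)
    (j : {additive D -> E}) :
  injective j -> exact_at f g -> exact_at f (j \o g).
Proof.
move=> ji ex y; rewrite -ex /=; split=> [e|->]; last exact: raddf0.
by apply: ji; rewrite raddf0.
Qed.

(** * Resolutions: shifting, splicing, free resolutions, finite length *)

Section Resolutions.
Variable T : pzRingType.
Implicit Types M K G A : lmodType T.

Section Shift.
Variables (M : lmodType T) (P : resolution M).

Definition image_corestr_fun (U V : lmodType T) (f : {linear U -> V}) (x : U) :
  image_mod f := Image (introT (asboolP _) (ex_intro _ x (erefl (f x)))).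

Lemma image_corestr_linear (U V : lmodType T) (f : {linear U -> V}) :
  linear (image_corestr_fun f).
Proof. by move=> a x y; apply: val_inj; exact: (linearP f). Qed.

Definition image_corestr (U V : lmodType T) (f : {linear U -> V}) :
  {linear U -> image_mod f} := linear_of (@image_corestr_linear U V f).

Lemma image_incl_linear (U V : lmodType T) (f : {linear U -> V}) :
  linear (@im_val _ _ _ f).
Proof. by move=> a x y; exact: (linearP (val : image_mod f -> V)). Qed.

Definition image_incl (U V : lmodType T) (f : {linear U -> V}) :
  {linear image_mod f -> V} := linear_of (@image_incl_linear U V f).

Lemma image_corestr_onto (U V : lmodType T) (f : {linear U -> V}) :
  onto (image_corestr f).
Proof.
by case=> y yP; have [x xE] := asboolP _ yP; exists x; apply: val_inj.
Qed.

Lemma image_corestr_eq0 (U V : lmodType T) (f : {linear U -> V}) x :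
  image_corestr f x = 0 <-> f x = 0.
Proof. by split=> [/(congr1 val) // | fx]; apply: val_inj. Qed.

(** Only the exactness proof is opaque: homology of [P] in degree k + 2 has to be, by conversion,
    that of the shift in degree k + 1. *)
Definition res_shift : resolution (image_mod (bd P 0)).
refine (@Resolution _ _ (fun i => res_term P i.+1) (fun i => bd P i.+1)
  (image_corestr (bd P 0)) (@image_corestr_onto _ _ _) _
  (fun i => @bd_exact _ _ P i.+1)).
abstract (by move=> y; rewrite image_corestr_eq0; exact: (@bd_exact _ _ P 0 y)).
Defined.

Lemma ses_res : ses (image_incl (bd P 0)) (aug P).
Proof.
split=> [x y /val_inj // | | y]; first exact: (@aug_surj _ _ P).
rewrite (@aug_exact _ _ P y); split=> [[x <-]|[x <-]].
  by exists (image_corestr (bd P 0) x).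
by have [z <-] := image_corestr_onto x; exists z.
Qed.

End Shift.

Section Cons.
Variables (K G M : lmodType T) (i : {linear K -> G}) (p : {linear G -> M}).
Variables (h : ses i p) (P : resolution K).

Definition cons_term (k : nat) : lmodType T := if k is k'.+1 then res_term P k' else G.

Definition cons_bd (k : nat) : {linear cons_term k.+1 -> cons_term k} :=
  match k with
  | 0 => (i \o aug P : {linear res_term P 0 -> G})
  | k'.+1 => bd P k'
  end.

Definition res_cons : resolution M.
refine (@Resolution _ _ cons_term cons_bd p _ _ _).
- abstract (by case: h).
- abstract (by case: h => _ _; apply: exact_precomp; exact: (@aug_surj _ _ P)).
- abstract (case: h => ii _ _ [|k]; last exact: (@bd_exact _ _ P k);
    exact: (exact_postcomp ii (@aug_exact _ _ P))).
Defined.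

End Cons.

Fixpoint free_term M (k : nat) : lmodType T :=
  if k is k'.+1 then free_term (free_syzygy M) k' else free_cover M.

Fixpoint free_bd M (k : nat) : {linear free_term M k.+1 -> free_term M k} :=
  match k with
  | 0 => (ker_incl (free_cover_map M) \o free_cover_map (free_syzygy M)
          : {linear free_cover (free_syzygy M) -> free_cover M})
  | k'.+1 => free_bd (free_syzygy M) k'
  end.

Definition free_resolution M : resolution M.
refine (@Resolution _ _ (free_term M) (free_bd M) (free_cover_map M)
  (@free_cover_map_onto _ M) _ _).
  abstract (case: (ses_free_cover M) => _ _; apply: exact_precomp;
    exact: free_cover_map_onto).
abstract (move=> k; elim: k M => [|k ih] M; last exact: ih;
  case: (ses_free_cover M) => ii _ _; apply: (exact_postcomp ii);
  case: (ses_free_cover (free_syzygy M)) => _ _; apply: exact_precomp;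
  exact: free_cover_map_onto).
Defined.

Lemma free_resolution_proj M : proj_resolution (free_resolution M).
Proof.
move=> k; rewrite /=; elim: k M => [|k ih] M /=; last exact: ih.
exact: projective_free_cover.
Qed.

Lemma res_cons_proj K G M (i : {linear K -> G}) (p : {linear G -> M}) (h : ses i p)
  (P : resolution K) : projective G -> proj_resolution P ->
  proj_resolution (res_cons h P).
Proof. by move=> Gp Pp [|k] //=; exact: Pp. Qed.

Section Length.
Variable X : lmodType T -> Prop.

Definition zero_mod : lmodType T := dsum (fun _ : void => T^o : lmodType T).

Lemma zero_mod0 (x : zero_mod) : x = 0.
Proof. by apply: dsumP => -[]. Qed.

Section Stalk.
Variable M : lmodType T.

Definition stalk_term (k : nat) : lmodType T := if k is k'.+1 then zero_mod else M.

Definition stalk_bd (k : nat) : {linear stalk_term k.+1 -> stalk_term k} :=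
  (\0 : {linear zero_mod -> stalk_term k}).

Definition stalk : resolution M.
refine (@Resolution _ _ stalk_term stalk_bd idfun _ _ _).
- abstract (by move=> y; exists y).
- abstract (by move=> y; split=> [e|[x <-]] //; exists 0; exact: esym e).
- abstract (by move=> k y; split=> [_|_] //; exists 0; rewrite [y]zero_mod0).
Defined.

End Stalk.

Lemma resolution_length0 M : X M -> has_resolution_of_length X M 0.
Proof.
by move=> XM; exists (stalk M); split=> [[|k]|[|k] _ x] //; exact: zero_mod0.
Qed.

Lemma resolution_lengthS K G M n (i : {linear K -> G}) (p : {linear G -> M}) :
  ses i p -> X G -> has_resolution_of_length X K n ->
  has_resolution_of_length X M n.+1.
Proof.
move=> h XG [P [PX P0]]; exists (res_cons h P).
by split=> -[|k] //=; [exact: PX | exact: P0].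
Qed.

(** [X] need not be closed under isomorphism, so [M] itself is not claimed to lie in it. *)
Lemma resolution_length0_inv M : has_resolution_of_length X M 0 ->
  exists2 A : lmodType T, X A & exists f : {linear A -> M}, injective f /\ onto f.
Proof.
case=> P [PX P0]; exists (res_term P 0); first exact: PX.
exists (aug P); split; last exact: (@aug_surj _ _ P).
apply: linear_inj => x /(@aug_exact _ _ P)[y <-].
by rewrite (P0 1%N isT y) linear0.
Qed.

Lemma resolution_lengthS_inv M n : has_resolution_of_length X M n.+1 ->
  exists (K A : lmodType T) (i : {linear K -> A}) (p : {linear A -> M}),
    [/\ ses i p, X A & has_resolution_of_length X K n].
Proof.
case=> P [PX P0]; exists (image_mod (bd P 0)), (res_term P 0).
exists (image_incl (bd P 0)), (aug P); split; first exact: ses_res; first exact: PX.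
exists (res_shift P); split=> k kn; [exact: (PX k.+1) | exact: (P0 k.+1)].
Qed.

End Length.
End Resolutions.

(** * Vanishing of Ext: dimension shifting and independence of choices *)

Section Ext.
Variable T : pzRingType.
Implicit Types K G X Y N A D E M : lmodType T.

(* Vanishing of Ext^(k+1)(X, N). *)
Fixpoint ext0 (k : nat) (X N : lmodType T) : Prop :=
  forall (K G : lmodType T) (i : {linear K -> G}) (p : {linear G -> X}),
    projective G -> ses i p ->
    match k with
    | 0 => forall f : {linear K -> N},
             exists h : {linear G -> N}, forall x, h (i x) = f x
    | k'.+1 => ext0 k' K N
    end.

(** The identity of [X] factors through [Y] up to a map through a projective, that is, [X] is a
    retract of [Y] in the stable category. This covers isomorphisms, direct summands and the
    comparison of two syzygies of one module. *)
Definition stable_retract X Y : Prop :=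
  exists (a : {linear X -> Y}) (b : {linear Y -> X}) (E : lmodType T)
         (u : {linear X -> E}) (v : {linear E -> X}),
    projective E /\ forall x, x = b (a x) + v (u x).

Lemma retract_stable X Y (a : {linear X -> Y}) (b : {linear Y -> X}) :
  (forall x, b (a x) = x) -> stable_retract X Y.
Proof.
move=> ba; exists a, b, (free_cover X), \0, \0; split.
  exact: projective_free_cover.
by move=> x; rewrite ba /= addr0.
Qed.

(** Stable retracts pass to syzygies: the maps lift to the projective covers and restrict to the
    kernels. The square with [a0] is kept because it is what lets maps be extended from [K] to
    [G]. *)
Lemma syzygy_stable_retract X X' K G K' G' (i : {linear K -> G})
    (p : {linear G -> X}) (i' : {linear K' -> G'}) (p' : {linear G' -> X'}) :
  projective G -> projective G' -> ses i p -> ses i' p' ->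
  stable_retract X X' ->
  exists (a : {linear K -> K'}) (a0 : {linear G -> G'}) (b : {linear K' -> K})
         (d : {linear G -> K}),
    (forall x, i' (a x) = a0 (i x)) /\ (forall x, x = b (a x) + d (i x)).
Proof.
move=> Gp Gp' h h' [a [b [E [u [v [Ep abE]]]]]].
have [ii po _] := h; have [_ po' _] := h'.
have [a0 a0E] := Gp _ _ p' (a \o p) po'.
have [b0 b0E] := Gp' _ _ p (b \o p') po.
have [v0 v0E] := Ep _ _ p v po.
have [a1 a1E] : exists g : {linear K -> K'}, forall x, i' (g x) = a0 (i x).
  apply: (ses_lift (f := a0 \o i) h') => x /=.
  by rewrite a0E /= (ses_comp0 _ h) linear0.
have [b1 b1E] : exists g : {linear K' -> K}, forall x, i (g x) = b0 (i' x).
  apply: (ses_lift (f := b0 \o i') h) => x /=.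
  by rewrite b0E /= (ses_comp0 _ h') linear0.
(* The map id - b0 a0 - v0 u p on [G] is killed by [p], hence lands in [K]; this yields [d], the
   part of the identity of [K] that factors through [G]. *)
have [w wE] := linear_sub (idfun : {linear G -> G}) (b0 \o a0).
have [w' w'E] := linear_sub w (v0 \o (u \o p)).
have [d dE] : exists g : {linear G -> K}, forall x, i (g x) = w' x.
  apply: (ses_lift h) => x; rewrite w'E wE !linearB /= b0E /= a0E v0E /=.
  by rewrite {1}[p x]abE addrAC addrK subrr.
exists a1, a0, b1, d; split=> // x; apply: ii.
rewrite linearD b1E a1E dE w'E wE /= (ses_comp0 _ h).
rewrite (linear0 u) (linear0 v0) subr0.
by rewrite addrC subrK.
Qed.

Lemma ext0_pres0 X X' N K G (i : {linear K -> G}) (p : {linear G -> X'}) :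
  projective G -> ses i p -> stable_retract X X' ->
  (forall f : {linear K -> N},
     exists h : {linear G -> N}, forall x, h (i x) = f x) ->
  ext0 0 X N.
Proof.
move=> Gp hs sr ext K1 G1 i1 p1 Gp1 hs1 f.
have [a [a0 [b [d [aE bE]]]]] := syzygy_stable_retract Gp1 Gp hs1 hs sr.
(* [f] is the sum of [f b a] and [f d i1]. If [h] extends [f b] along [i], then [h a0] extends the
   first term along [i1], and [f d] extends the second. *)
have [h hE] := ext (f \o b).
have [g gE] := linear_add (h \o a0) (f \o d).
by exists g => x; rewrite gE /= -aE hE /= -linearD -bE.
Qed.

Lemma ext0_stable k X X' N : stable_retract X X' -> ext0 k X' N -> ext0 k X N.
Proof.
have Fp Y := @projective_free_cover _ Y; have Fs Y := @ses_free_cover _ Y.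
elim: k X X' => [|k ih] X X' sr e.
  exact: (ext0_pres0 (Fp X') (Fs X') sr (e _ _ _ _ (Fp X') (Fs X'))).
move=> K G i p Gp hs; apply: (ih _ _ _ (e _ _ _ _ (Fp X') (Fs X'))).
have [a [_ [b [d [_ bE]]]]] := syzygy_stable_retract Gp (Fp X') hs (Fs X') sr.
by exists a, b, G, i, d.
Qed.

Lemma ext0_presS k X N K G (i : {linear K -> G}) (p : {linear G -> X}) :
  projective G -> ses i p -> ext0 k.+1 X N <-> ext0 k K N.
Proof.
move=> Gp hs; split=> [e|e K1 G1 i1 p1 Gp1 hs1]; first exact: (e _ _ _ _ Gp hs).
have sr : stable_retract X X by apply: (@retract_stable X X idfun idfun).
apply: ext0_stable e.
have [a [_ [b [d [_ bE]]]]] := syzygy_stable_retract Gp1 Gp hs1 hs sr.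
by exists a, b, G1, i1, d.
Qed.

(** A single projective resolution decides the vanishing: shift down to degree 1, where cocycles on
    P_1 are the maps out of the first syzygy. *)
Lemma ext0_resP k X N (P : resolution X) : proj_resolution P ->
  Hom_cohomology_eq0 N P k.+1 <-> ext0 k X N.
Proof.
elim: k X P => [|k ih] X P Pp; last first.
  rewrite (ext0_presS _ _ (Pp 0%N) (ses_res P)).
  by apply: (ih _ (res_shift P)) => i; exact: Pp.
split=> [H|e f f0].
  apply: (ext0_pres0 (Pp 0%N) (ses_res P)).
    exact: (@retract_stable X X idfun idfun).
  move=> f; have [x|h hE] := H (f \o image_corestr (bd P 0)).
    rewrite /= -[RHS](linear0 f); congr (f _); apply/image_corestr_eq0.
    by apply/(@bd_exact _ _ P 0); exists x.
  by exists h => x; have [z <-] := image_corestr_onto x; rewrite -hE.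
have [|g gE] := factor_through_onto (f := f) (@image_corestr_onto _ _ _ (bd P 0)).
  by move=> x /image_corestr_eq0/(@bd_exact _ _ P 0)[y <-].
have [h hE] := e _ _ _ _ (Pp 0%N) (ses_res P) g.
by exists h => x; rewrite -gE -hE.
Qed.

Lemma Ext_eq0E k X N : Ext_eq0 k.+1 X N <-> ext0 k X N.
Proof.
split=> [e|e P Pp]; last exact/ext0_resP.
by apply/(ext0_resP _ _ (@free_resolution_proj T X)); apply/e/free_resolution_proj.
Qed.

(** The direct sum of the free presentations of the W_j presents their sum, and maps out of a direct
    sum extend summand by summand. *)
Lemma ext0_dsum k (J : Type) (W : J -> lmodType T) N :
  (forall j, ext0 k (W j) N) -> ext0 k (dsum W) N.
Proof.
have Fp Y := @projective_free_cover _ Y; have Fs Y := @ses_free_cover _ Y.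
elim: k W => [|k ih] W e; last first.
  have hs := ses_dsum (fun j => Fs (W j)).
  apply/(ext0_presS _ _ (projective_dsum (fun j => Fp (W j))) hs)/ih => j.
  exact: (e j _ _ _ _ (Fp (W j)) (Fs (W j))).
apply: (ext0_pres0 (projective_dsum (fun j => Fp (W j))) (ses_dsum (fun j => Fs (W j)))).
  exact: (@retract_stable _ _ idfun idfun).
move=> f.
have h_ex j := e j _ _ _ _ (Fp (W j)) (Fs (W j)) (f \o dsum_in (fun j => free_syzygy (W j)) j).
pose h j := projT1 (cid (h_ex j)).
have hE j x : h j (ker_incl (free_cover_map (W j)) x) =
    f (dsum_in (fun j => free_syzygy (W j)) j x).
  by rewrite /h; case: cid => g /= ->.
exists (dsum_lift h) => x.
apply: (dsum_ext (h := dsum_lift h \o dsum_map (fun j => ker_incl (free_cover_map (W j))))).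
move=> j y; rewrite -hE -(dsum_lift_in h) /=; congr (dsum_lift_fun _ _).
apply: dsumP => l /=; case: (pselect (j = l)) => [<-|jl].
  by rewrite !dsum_single_same.
by rewrite !dsum_single_neq.
Qed.

Section UltimatelyClosed.

Lemma bij_linear_inv X Y (f : {linear X -> Y}) : bijective f ->
  exists g : {linear Y -> X}, cancel f g /\ cancel g f.
Proof.
case=> g fg gf; suff gl : linear g by exists (linear_of gl).
by move=> a x y; apply: (can_inj fg); rewrite gf linearP !gf.
Qed.

Lemma image_aug_stable X (P : resolution X) :
  stable_retract X (image_mod (aug P)) /\ stable_retract (image_mod (aug P)) X.
Proof.
have [|g gE] := @lift_through_inj _ _ _ X (image_incl (aug P)) idfun (@val_inj _ _ _).
  by move=> x; have [y <-] := @aug_surj _ _ P x; exists (image_corestr (aug P) y).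
split; first exact: (@retract_stable _ _ g (image_incl (aug P))).
by apply: (@retract_stable _ _ (image_incl (aug P)) g) => x; apply: val_inj; exact: gE.
Qed.

Lemma ext0_syzygy k i X N (P : resolution X) : proj_resolution P ->
  ext0 (k + i) X N <-> ext0 k (syzygy P i) N.
Proof.
case: i => [|i] Pp.
  rewrite addn0; have [s s'] := image_aug_stable P.
  by split; apply: ext0_stable.
rewrite addnS; elim: i X P Pp => [|i ih] X P Pp.
  by rewrite addn0 (ext0_presS _ _ (Pp 0%N) (ses_res P)).
rewrite (ext0_presS _ _ (Pp 0%N) (ses_res P)) addnS.
by apply: (ih _ (res_shift P)) => j; exact: Pp.
Qed.

(** For k >= m, shift from X to its m-th syzygy. Its summands W_j are summands of i-th syzygies with
    i < m, so shifting back leads to index k - m + i < k, and strong induction on k applies. *)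
Lemma ultimately_closed_ext0 X N m : ultimately_closed_at X m ->
  (forall k, (k < m)%N -> ext0 k X N) -> forall k, ext0 k X N.
Proof.
case=> P [Pp [J [W [[f /bij_linear_inv[g [fK gK]]] Wi]]]] e k.
have [n kn] := ubnP k; elim: n => // n ih in k kn *.
have [/e //|mk] := ltnP k m; rewrite -(subnK mk); apply/(ext0_syzygy _ _ _ Pp).
apply: (@ext0_stable _ _ (dsum W)); first exact: (@retract_stable _ _ f g).
apply: ext0_dsum => j; have [i [im [V [a /bij_linear_inv[b [aK bK]]]]]] := Wi j.
have [inl inlE] : exists h : {linear W j -> (W j * V)%type}, forall x, h x = (x, 0).
  suff hl : linear (fun x : W j => (x, 0 : V)) by exists (linear_of hl).
  by move=> c x y; congr (_, _); rewrite /= scaler0 addr0.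
have [pr prE] : exists h : {linear (W j * V)%type -> W j}, forall x, h x = x.1.
  suff hl : linear (fun x : W j * V => x.1) by exists (linear_of hl).
  by [].
apply: (@ext0_stable _ _ (syzygy P i)).
  apply: (@retract_stable _ _ (a \o inl) (pr \o b)) => x /=.
  by rewrite aK prE inlE.
apply/(ext0_syzygy _ _ _ Pp)/ih; apply: leq_trans (_ : (k <= n)%N) => //.
by rewrite -[leqRHS](subnK mk) ltn_add2l.
Qed.

End UltimatelyClosed.

(** * Fragments of the long exact sequence of Ext(X, -) *)

Section LongExact.
Variables (A B D : lmodType T) (i : {linear A -> B}) (p : {linear B -> D}).
Hypothesis h : ses i p.

(** Lift [f] on a free cover of X. On the syzygy the lift takes values in A; extending that part to
    the cover and subtracting it lets the lift descend to X. *)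
Lemma ext0_lift X (f : {linear X -> D}) : ext0 0 X A ->
  exists g : {linear X -> B}, forall x, p (g x) = f x.
Proof.
move=> e; have [ii po _] := h.
have Fp := @projective_free_cover _ X; have Fs := @ses_free_cover _ X.
have [_ qo qex] := Fs.
have [g gE] := Fp _ _ p (f \o free_cover_map X) po.
have [c cE] : exists c : {linear free_syzygy X -> A},
    forall x, i (c x) = g (ker_incl (free_cover_map X) x).
  apply: (ses_lift (f := g \o ker_incl (free_cover_map X)) h) => x.
  by rewrite [LHS]gE [LHS](congr1 f (ses_comp0 x Fs)) linear0.
have [w wE] := e _ _ _ _ Fp Fs c.
have [l lE] := linear_sub g (i \o w).
have [|r rE] := factor_through_onto (f := l) qo.
  by move=> x /qex[y <-]; rewrite lE /= wE cE subrr.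
exists r => x; have [y <-] := qo x.
by rewrite rE lE linearB gE /= (ses_comp0 _ h) subr0.
Qed.

(** Exactness of Hom(X, B) -> Hom(X, D) -> Ext^1(X, A) -> Ext^1(X, B). *)
Lemma ext0_of_lift X :
  (forall f : {linear X -> D}, exists g : {linear X -> B}, forall x, p (g x) = f x) ->
  ext0 0 X B -> ext0 0 X A.
Proof.
move=> lift e K G j q Gp hs f; have [ii _ _] := h; have [_ qo qex] := hs.
have [w wE] := e _ _ _ _ Gp hs (i \o f).
have [|g gE] := factor_through_onto (f := p \o w) qo.
  by move=> x /qex[y <-] /=; rewrite wE /= (ses_comp0 _ h).
have [g' g'E] := lift g.
have [l lE] := linear_sub w (g' \o q).
have [|r rE] := ses_lift (f := l) h.
  by move=> x; rewrite lE linearB /= g'E gE subrr.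
exists r => x; apply: ii.
by rewrite rE lE wE /= (ses_comp0 _ hs) linear0 subr0.
Qed.

(** In the base case a map from a syzygy of X to D extends to the projective cover and lifts from
    there to B, so [ext0_of_lift] applies to the syzygy. *)
Lemma ext0_les_left k X : ext0 k X D -> ext0 k.+1 X B -> ext0 k.+1 X A.
Proof.
elim: k X => [|k ih] X eD eB K G j q Gp hs; last first.
  by apply: ih; [exact: (eD _ _ _ _ Gp hs) | exact: (eB _ _ _ _ Gp hs)].
apply: ext0_of_lift; last exact: (eB _ _ _ _ Gp hs).
move=> f; have [g gE] := eD _ _ _ _ Gp hs f.
have [_ po _] := h; have [w wE] := Gp _ _ p g po.
by exists (w \o j) => x; rewrite /= wE gE.
Qed.

Lemma ext0_les_right k X : ext0 k.+1 X A -> ext0 k X B -> ext0 k X D.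
Proof.
elim: k X => [|k ih] X eA eB K G j q Gp hs; last first.
  by apply: ih; [exact: (eA _ _ _ _ Gp hs) | exact: (eB _ _ _ _ Gp hs)].
move=> f; have [g gE] := ext0_lift f (eA _ _ _ _ Gp hs).
have [w wE] := eB _ _ _ _ Gp hs g.
by exists (p \o w) => x; rewrite /= wE gE.
Qed.

End LongExact.
End Ext.

(** * Functoriality and right exactness of the tensor product *)

Section TensorMaps.
Variable T : pzRingType.
Implicit Types (X Y Z C : lmodType T^c) (N M L : lmodType T).

Lemma tensDl X N (c c' : X) (x : N) : tens (c + c') x = tens c x + tens c' x.
Proof. by have [tD _ _] := tens_balanced X N; exact: tD. Qed.

Lemma tensDr X N (c : X) (x x' : N) : tens c (x + x') = tens c x + tens c x'.
Proof. by have [_ tD _] := tens_balanced X N; exact: tD. Qed.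

Lemma tensZ X N (s : T) (c : X) (x : N) : tens ((s : T^c) *: c) x = tens c (s *: x).
Proof. by have [_ _ tZ] := tens_balanced X N; exact: tZ. Qed.

Definition tensor_lift_additive X N (A : zmodType) (f : X -> N -> A)
    (bf : balanced f) : {additive tensor X N -> A} :=
  additive_of (morphD_morphB (tensor_lift_add bf)).

Lemma tensr_linear0 X N (c : X) : tens c (0 : N) = 0.
Proof. by apply: (addrI (tens c 0)); rewrite -tensDr !addr0. Qed.

Lemma tensl_linear0 X N (x : N) : tens (0 : X) x = 0.
Proof. by apply: (addrI (tens 0 x)); rewrite -tensDl !addr0. Qed.

Lemma tens_sumr X N (c : X) (I : Type) (r : seq I) (F : I -> N) :
  tens c (\sum_(i <- r) F i) = \sum_(i <- r) tens c (F i).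
Proof.
elim: r => [|i r ih]; first by rewrite !big_nil tensr_linear0.
by rewrite !big_cons tensDr ih.
Qed.

Lemma tens_suml X N (x : N) (I : Type) (r : seq I) (F : I -> X) :
  tens (\sum_(i <- r) F i) x = \sum_(i <- r) tens (F i) x.
Proof.
elim: r => [|i r ih]; first by rewrite !big_nil tensl_linear0.
by rewrite !big_cons tensDl ih.
Qed.

Lemma tensB X N (c : X) (x x' : N) : tens c (x - x') = tens c x - tens c x'.
Proof. exact: (morphD_morphB (tensDr c)). Qed.

Lemma tensBl X N (c c' : X) (x : N) : tens (c - c') x = tens c x - tens c' x.
Proof. exact: (morphD_morphB (fun a b => tensDl a b x)). Qed.

Lemma tensor_ext X N (A : zmodType) (f g : {additive tensor X N -> A}) :
  (forall c x, f (tens c x) = g (tens c x)) -> forall t, f t = g t.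
Proof.
by move=> fg; elim/tensor_ind => [|c x t ih]; rewrite ?raddf0 // !raddfD fg ih.
Qed.

Lemma tensor_map_balanced C N M (g : {linear N -> M}) :
  balanced (fun (c : C) x => tens c (g x)).
Proof.
split=> [c c' x|c x x'|s c x]; first exact: tensDl.
  by rewrite linearD tensDr.
by rewrite linearZ tensZ.
Qed.

Lemma tensor_mapB C N M (g : {linear N -> M}) :
  {morph tensor_map C g : t u / t - u}.
Proof. exact: (morphD_morphB (tensor_lift_add (tensor_map_balanced C g))). Qed.

HB.instance Definition _ C N M (g : {linear N -> M}) :=
  GRing.isZmodMorphism.Build (tensor C N) (tensor C M) (tensor_map C g)
    (@tensor_mapB C N M g).

Lemma tensor_mapE C N M (g : {linear N -> M}) c x :
  tensor_map C g (tens c x) = tens c (g x).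
Proof. exact: (tensor_lift_tens _ _ (tensor_map_balanced C g)). Qed.

Definition tensor_mapl X Y N (f : {linear X -> Y}) : tensor X N -> tensor Y N :=
  tensor_lift (fun c x => tens (f c) x).

Lemma tensor_mapl_balanced X Y N (f : {linear X -> Y}) :
  balanced (fun (c : X) (x : N) => tens (f c) x).
Proof.
split=> [c c' x|c x x'|s c x]; last by rewrite linearZ tensZ.
  by rewrite linearD tensDl.
exact: tensDr.
Qed.

Lemma tensor_maplB X Y N (f : {linear X -> Y}) :
  {morph @tensor_mapl X Y N f : t u / t - u}.
Proof. exact: (morphD_morphB (tensor_lift_add (tensor_mapl_balanced N f))). Qed.

HB.instance Definition _ X Y N (f : {linear X -> Y}) :=
  GRing.isZmodMorphism.Build (tensor X N) (tensor Y N) (tensor_mapl f)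
    (@tensor_maplB X Y N f).

Lemma tensor_maplE X Y N (f : {linear X -> Y}) c (x : N) :
  tensor_mapl f (tens c x) = tens (f c) x.
Proof. exact: (tensor_lift_tens _ _ (tensor_mapl_balanced N f)). Qed.

Lemma tensor_map_comp C N M L (g : {linear N -> M}) (g' : {linear M -> L})
    (h : {linear N -> L}) t :
  (forall x, h x = g' (g x)) -> tensor_map C g' (tensor_map C g t) = tensor_map C h t.
Proof.
move=> hE; apply: (tensor_ext (f := tensor_map C g' \o tensor_map C g)) => c x /=.
by rewrite !tensor_mapE hE.
Qed.

Lemma tensor_mapl_comp X Y Z N (g : {linear X -> Y}) (g' : {linear Y -> Z})
    (h : {linear X -> Z}) (t : tensor X N) :
  (forall x, h x = g' (g x)) -> tensor_mapl g' (tensor_mapl g t) = tensor_mapl h t.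
Proof.
move=> hE; apply: (tensor_ext (f := tensor_mapl g' \o tensor_mapl g)) => c x /=.
by rewrite !tensor_maplE hE.
Qed.

Lemma tensor_mapl_map X Y N M (f : {linear X -> Y}) (g : {linear N -> M}) t :
  tensor_mapl f (tensor_map X g t) = tensor_map Y g (tensor_mapl f t).
Proof.
apply: (tensor_ext (f := tensor_mapl f \o tensor_map X g)
                   (g := tensor_map Y g \o tensor_mapl f)) => c x /=.
by rewrite !(tensor_mapE, tensor_maplE).
Qed.

Lemma tensor_map_onto C N M (p : {linear N -> M}) : onto p -> onto (tensor_map C p).
Proof.
move=> po; elim/tensor_ind => [|c x t [u <-]]; first by exists 0; rewrite raddf0.
by have [y <-] := po x; exists (tens c y + u); rewrite raddfD /= tensor_mapE.
Qed.

Lemma tensor_mapl_onto X Y N (p : {linear X -> Y}) :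
  onto p -> onto (@tensor_mapl X Y N p).
Proof.
move=> po; elim/tensor_ind => [|c x t [u <-]]; first by exists 0; rewrite raddf0.
by have [y <-] := po c; exists (tens y x + u); rewrite raddfD /= tensor_maplE.
Qed.

(** Let q be the cokernel map of C (x) i. Since q(c (x) x) depends only on p x, a set-theoretic
    section of p defines a balanced map through which q factors as a map after C (x) p; so the
    kernel of C (x) p lies in that of q. *)
Lemma tensor_map_exact C N M L (i : {linear N -> M}) (p : {linear M -> L}) :
  onto p -> exact_at i p -> exact_at (tensor_map C i) (tensor_map C p).
Proof.
move=> po ex t; split=> [pt|[u <-]]; last first.
  rewrite (tensor_map_comp (h := \0)).
    elim/tensor_ind: u => [|c x u ih]; first exact: raddf0.
    by rewrite raddfD /= ih tensor_mapE tensr_linear0 addr0.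
  by move=> x; apply/esym/ex; exists x.
have [D [q [qo qex]]] := additive_coker (tensor_map C i); apply/qex.
have qp c x x' : p x = p x' -> q (tens c x) = q (tens c x').
  move=> e; apply/eqP; rewrite -subr_eq0 -raddfB -tensB; apply/eqP/qex.
  have /ex[y <-] : p (x - x') = 0 by rewrite linearB e subrr.
  by exists (tens c y); exact: tensor_mapE.
have /choice[s sE] := po.
have bf : balanced (fun (c : C) y => q (tens c (s y))).
  split=> [c c' y|c y y'|a c y]; first by rewrite tensDl raddfD.
    by rewrite -raddfD -tensDr; apply: qp; rewrite linearD !sE.
  by rewrite tensZ; apply: qp; rewrite linearZ /= !sE.
have <- : tensor_lift_additive bf (tensor_map C p t) = q t.
  apply: (tensor_ext (f := tensor_lift_additive bf \o tensor_map C p)) => c x.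
  rewrite [LHS](congr1 _ (tensor_mapE p c x)) [LHS](tensor_lift_tens _ _ bf).
  by apply: qp; rewrite sE.
by rewrite pt raddf0.
Qed.

Lemma tensor_mapl_exact X Y Z N (i : {linear X -> Y}) (p : {linear Y -> Z}) :
  onto p -> exact_at i p ->
  exact_at (@tensor_mapl X Y N i) (@tensor_mapl Y Z N p).
Proof.
move=> po ex t; split=> [pt|[u <-]]; last first.
  rewrite (tensor_mapl_comp (h := \0)).
    elim/tensor_ind: u => [|c x u ih]; first exact: raddf0.
    by rewrite raddfD /= ih tensor_maplE tensl_linear0 addr0.
  by move=> x; apply/esym/ex; exists x.
have [D [q [qo qex]]] := additive_coker (@tensor_mapl X Y N i); apply/qex.
have qp c c' x : p c = p c' -> q (tens c x) = q (tens c' x).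
  move=> e; apply/eqP; rewrite -subr_eq0 -raddfB -tensBl; apply/eqP/qex.
  have /ex[y <-] : p (c - c') = 0 by rewrite linearB e subrr.
  by exists (tens y x); exact: tensor_maplE.
have /choice[s sE] := po.
have bf : balanced (fun (c : Z) (y : N) => q (tens (s c) y)).
  split=> [c c' y|c y y'|a c y].
  - by rewrite -raddfD -tensDl; apply: qp; rewrite linearD !sE.
  - by rewrite tensDr raddfD.
  - by rewrite -tensZ; apply: qp; rewrite linearZ /= !sE.
have <- : tensor_lift_additive bf (tensor_mapl p t) = q t.
  apply: (tensor_ext (f := tensor_lift_additive bf \o tensor_mapl p)) => c x.
  rewrite [LHS](congr1 _ (tensor_maplE p c x)) [LHS](tensor_lift_tens _ _ bf).
  by apply: qp; rewrite sE.
by rewrite pt raddf0.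
Qed.

End TensorMaps.

(** * Coordinates in tensor products; projective modules are flat *)

Section Coordinates.
Variable T : pzRingType.

Section Right.
Variables (X : lmodType T^c) (Q : lmodType T).

Section OneForm.
Variable psi : {linear Q -> T^o}.

(** Right multiplication of [c] by the scalar [psi x], so that X (x) Q -> X is id (x) psi followed
    by X (x) T = X. *)
Definition coordr_fun : X -> Q -> X := fun c x => (psi x : T^c) *: c.

Lemma coordr_balanced : balanced coordr_fun.
Proof.
split=> [c c' x|c x x'|s c x]; rewrite /coordr_fun.
- exact: scalerDr.
- by rewrite linearD; exact: scalerDl.
- by rewrite scalerA linearZ.
Qed.

Definition coordr : {additive tensor X Q -> X} :=
  tensor_lift_additive coordr_balanced.

Lemma coordr_tens c x : coordr (tens c x) = (psi x : T^c) *: c.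
Proof. exact: (tensor_lift_tens _ _ coordr_balanced). Qed.

End OneForm.

Lemma coordr_basis (phi : Q -> {linear Q -> T^o}) (t : tensor X Q) :
  dual_basis phi ->
  exists s : seq {classic Q},
    (forall q : {classic Q}, q \notin s -> coordr (phi q) t = 0) /\
    forall r : seq {classic Q}, uniq r -> {subset s <= r} ->
      t = \sum_(q <- r) tens (coordr (phi q) t) (q : Q).
Proof.
move=> phiB; elim/tensor_ind: t => [|c x t [s [s0 sE]]].
  exists [::]; split=> [q _|r _ _]; first exact: raddf0.
  by rewrite big1 // => q _; rewrite raddf0 tensl_linear0.
have [s' [s'0 s'E]] := phiB x; exists (s' ++ s); split=> [q|r ur sr].
  rewrite mem_cat negb_or => /andP[/s'0 qs' /s0 qs].
  by rewrite raddfD coordr_tens qs' qs scale0r addr0.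
have sr1 : {subset s <= r} by move=> q qs; apply: sr; rewrite mem_cat qs orbT.
have sr2 : {subset s' <= r} by move=> q qs; apply: sr; rewrite mem_cat qs.
rewrite [in LHS](sE r ur sr1) [in LHS](s'E r ur sr2).
rewrite tens_sumr -big_split; apply: eq_bigr => q _.
by rewrite raddfD coordr_tens tensDl tensZ.
Qed.

End Right.

Section Left.
Variables (X : lmodType T^c) (N : lmodType T).

Section OneForm.
Variable psi : {linear X -> T^c^o}.

Definition coordl_fun : X -> N -> N := fun c x => (psi c : T) *: x.

Lemma coordl_balanced : balanced coordl_fun.
Proof.
split=> [c c' x|c x x'|s c x]; rewrite /coordl_fun.
- by rewrite linearD; exact: scalerDl.
- exact: scalerDr.
- by rewrite scalerA linearZ.
Qed.

Definition coordl : {additive tensor X N -> N} :=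
  tensor_lift_additive coordl_balanced.

Lemma coordl_tens c x : coordl (tens c x) = (psi c : T) *: x.
Proof. exact: (tensor_lift_tens _ _ coordl_balanced). Qed.

End OneForm.

Lemma coordl_basis (phi : X -> {linear X -> T^c^o}) (t : tensor X N) :
  dual_basis phi ->
  exists s : seq {classic X}, forall r : seq {classic X}, uniq r -> {subset s <= r} ->
      t = \sum_(q <- r) tens (q : X) (coordl (phi q) t).
Proof.
move=> phiB; elim/tensor_ind: t => [|c x t [s sE]].
  exists [::] => r _ _.
  by rewrite big1 // => q _; rewrite raddf0 tensr_linear0.
have [s' [s'0 s'E]] := phiB c; exists (s' ++ s) => r ur sr.
have sr1 : {subset s <= r} by move=> q qs; apply: sr; rewrite mem_cat qs orbT.
have sr2 : {subset s' <= r} by move=> q qs; apply: sr; rewrite mem_cat qs.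
rewrite [in LHS](sE r ur sr1) [in LHS](s'E r ur sr2).
rewrite tens_suml -big_split; apply: eq_bigr => q _.
by rewrite raddfD coordl_tens tensDr tensZ.
Qed.

End Left.

(** Coordinates along a dual basis of [X] commute with [i], and an element of X (x) N with zero
    coordinates is zero. *)
Lemma tensor_map_flat (X : lmodType T^c) (N M : lmodType T) (i : {linear N -> M}) :
  projective X -> injective i -> forall t, tensor_map X i t = 0 -> t = 0.
Proof.
move=> /projective_dual_basis[phi phiB] ii t it.
have [s sE] := coordl_basis t phiB.
rewrite (sE (undup s)) ?undup_uniq //; last by move=> q; rewrite mem_undup.
rewrite big1 // => q _; suff -> : coordl N (phi q) t = 0 by exact: tensr_linear0.
apply: ii; rewrite linear0 -(raddf0 (coordl M (phi q))) -it.
apply: (tensor_ext (f := i \o coordl N (phi q)) (g := coordl M (phi q) \o tensor_map X i)).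
by move=> c x; rewrite /= tensor_mapE
  !(tensor_lift_tens _ _ (coordl_balanced _ _)) /coordl_fun linearZ.
Qed.

Lemma tensor_mapl_flat (Q : lmodType T) (X Y : lmodType T^c) (i : {linear X -> Y}) :
  projective Q -> injective i -> forall t : tensor X Q, tensor_mapl i t = 0 -> t = 0.
Proof.
move=> /projective_dual_basis[phi phiB] ii t it.
have [s [_ sE]] := coordr_basis t phiB.
rewrite (sE (undup s)) ?undup_uniq //; last by move=> q; rewrite mem_undup.
rewrite big1 // => q _; suff -> : coordr X (phi q) t = 0 by exact: tensl_linear0.
apply: ii; rewrite linear0 -(raddf0 (coordr Y (phi q))) -it.
apply: (tensor_ext (f := i \o coordr X (phi q)) (g := coordr Y (phi q) \o tensor_mapl i)).
by move=> c x; rewrite /= tensor_maplE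
  !(tensor_lift_tens _ _ (coordr_balanced _ _)) /coordr_fun linearZ.
Qed.

End Coordinates.

(* With rows X' (x) -, F (x) -, X (x) - and columns - (x) K, - (x) G, - (x) N, *)
(* this snake compares the kernels of X (x) K -> X (x) G and X' (x) N -> F (x) N. *)
Lemma grid_snake (A00 A01 A02 A10 A11 A12 A20 A21 : zmodType)
    (h00 : {additive A00 -> A01}) (h01 : {additive A01 -> A02})
    (h10 : {additive A10 -> A11}) (h11 : {additive A11 -> A12})
    (h20 : {additive A20 -> A21})
    (v00 : {additive A00 -> A10}) (v10 : {additive A10 -> A20})
    (v01 : {additive A01 -> A11}) (v11 : {additive A11 -> A21})
    (v02 : {additive A02 -> A12}) :
  onto v10 -> exact_at v00 v10 -> exact_at v01 v11 -> exact_at h00 h01 ->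
  exact_at h10 h11 ->
  (forall x, v01 (h00 x) = h10 (v00 x)) -> (forall x, v02 (h01 x) = h11 (v01 x)) ->
  (forall x, h20 (v10 x) = v11 (h10 x)) ->
  (forall x, h10 x = 0 -> x = 0) -> (forall x, v02 x = 0 -> x = 0) ->
  forall x, h20 x = 0 -> x = 0.
Proof.
move=> vo ev0 ev1 eh0 eh1 sq0 sq1 sq2 ih iv x hx.
have [y yx] := vo x; have /ev1[z zy] : v11 (h10 y) = 0 by rewrite -sq2 yx.
have /iv/eh0[w wz] : v02 (h01 z) = 0 by rewrite sq1 zy; apply/eh1; exists y.
rewrite -yx; apply/ev0; exists w; apply/eqP; rewrite -subr_eq0; apply/eqP/ih.
by rewrite raddfB -sq0 wz zy subrr.
Qed.

(** * Vanishing of Tor, computed through either variable *)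

Section Tor.
Variable T : pzRingType.
Implicit Types (X Y F : lmodType T^c) (N M K G A : lmodType T).

(* Vanishing of Tor_(k+1)(X, N). *)
Fixpoint tor0 (k : nat) (X : lmodType T^c) (N : lmodType T) : Prop :=
  forall (K G : lmodType T) (i : {linear K -> G}) (p : {linear G -> N}),
    projective G -> ses i p ->
    match k with
    | 0 => forall t, tensor_map X i t = 0 -> t = 0
    | k'.+1 => tor0 k' X K
    end.

Section Symmetry.
Variables (X' F X : lmodType T^c) (j : {linear X' -> F}) (q : {linear F -> X}).
Variables (N' M N : lmodType T) (i : {linear N' -> M}) (p : {linear M -> N}).
Hypotheses (hq : ses j q) (hp : ses i p) (Fp : projective F).

Lemma tensor_ses_symr : (forall t : tensor X' N, tensor_mapl j t = 0 -> t = 0) ->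
  forall t, tensor_map X i t = 0 -> t = 0.
Proof.
have [ji qo qex] := hq; have [ii po pex] := hp.
apply: (@grid_snake _ _ _ _ _ _ _ _ (tensor_map X' i) (tensor_map X' p)
  (tensor_map F i) (tensor_map F p) (tensor_map X i) (tensor_mapl j) (tensor_mapl q)
  (tensor_mapl j) (tensor_mapl q) (tensor_mapl j)).
- exact: tensor_mapl_onto.
- exact: tensor_mapl_exact.
- exact: tensor_mapl_exact.
- exact: tensor_map_exact.
- exact: tensor_map_exact.
- exact: tensor_mapl_map.
- exact: tensor_mapl_map.
- by move=> x; apply/esym; exact: tensor_mapl_map.
- exact: tensor_map_flat.
Qed.

Lemma tensor_ses_syml : (forall t : tensor X' M, tensor_mapl j t = 0 -> t = 0) ->
  (forall t, tensor_map X i t = 0 -> t = 0) ->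
  forall t : tensor X' N, tensor_mapl j t = 0 -> t = 0.
Proof.
move=> jM; have [ji qo qex] := hq; have [ii po pex] := hp.
apply: (@grid_snake _ _ _ _ _ _ _ _ (tensor_mapl j) (tensor_mapl q)
  (tensor_mapl j) (tensor_mapl q) (tensor_mapl j) (tensor_map X' i) (tensor_map X' p)
  (tensor_map F i) (tensor_map F p) (tensor_map X i)).
- exact: tensor_map_onto.
- exact: tensor_map_exact.
- exact: tensor_map_exact.
- exact: tensor_mapl_exact.
- exact: tensor_mapl_exact.
- by move=> x; apply/esym; exact: tensor_mapl_map.
- by move=> x; apply/esym; exact: tensor_mapl_map.
- exact: tensor_mapl_map.
- exact: jM.
Qed.

End Symmetry.

Section FirstVariable.
Variables (X' F X : lmodType T^c) (j : {linear X' -> F}) (q : {linear F -> X}).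
Hypotheses (hq : ses j q) (Fp : projective F).

(** Balancing of Tor_1: a presentation of the first argument detects it as well. The two symmetry
    lemmas exchange the roles of the presentations, by flatness of the projective terms. *)
Lemma tor0_first N :
  tor0 0 X N <-> (forall t : tensor X' N, tensor_mapl j t = 0 -> t = 0).
Proof.
have [ji _ _] := hq; split=> [e|e K G i p Gp hs]; last exact: tensor_ses_symr hq hs Fp e.
have Gp := @projective_free_cover _ N; have hs := @ses_free_cover _ N.
apply: (tensor_ses_syml hq hs); last exact: (e _ _ _ _ Gp hs).
exact: tensor_mapl_flat.
Qed.

(** For k = 0 both sides concern the kernel of X' (x) K -> F (x) G: flatness of F identifies it with
    the kernel into F (x) K, flatness of G with the kernel into X' (x) G. *)
Lemma tor0S_first k N : tor0 k.+1 X N <-> tor0 k X' N.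
Proof.
have [ji _ _] := hq; elim: k N => [|k ih] N; last first.
  split=> e K G i p Gp hs; first exact/ih/(e _ _ _ _ Gp hs).
  exact/ih/(e _ _ _ _ Gp hs).
split=> e K G i p Gp hs; have [ii _ _] := hs.
  move=> t it; have /tor0_first eK := e _ _ _ _ Gp hs; apply: eK.
  apply: (tensor_map_flat Fp ii).
  by rewrite -tensor_mapl_map it raddf0.
apply/tor0_first => t jt; apply: (e _ _ _ _ Gp hs).
apply: (tensor_mapl_flat Gp ji).
by rewrite tensor_mapl_map jt raddf0.
Qed.

End FirstVariable.

Lemma tor0_projectivel k X N : projective X -> tor0 k X N.
Proof.
move=> Xp; elim: k N => [|k ih] N K G i p Gp [ii _ _]; last exact: ih.
exact: tensor_map_flat.
Qed.

Lemma tor0_projectiver k X N : projective N -> tor0 k X N.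
Proof.
move=> Np; elim: k X => [|k ih] X; have hs := @ses_free_cover _ X;
  have Fp := @projective_free_cover _ X.
  by apply/(tor0_first hs Fp); apply: tensor_mapl_flat => //; case: hs.
exact/(tor0S_first hs Fp).
Qed.

Lemma tor0_res k X N (P : resolution N) : proj_resolution P -> tor0 k X N ->
  tensor_homology_eq0 X P k.+1.
Proof.
elim: k N P => [|k ih] N P Pp e; last first.
  apply: (ih _ (res_shift P)) => [i|]; first exact: Pp.
  exact: (e _ _ _ _ (Pp 0%N) (ses_res P)).
move=> y.
have ey : tensor_map X (bd P 0) y =
    tensor_map X (image_incl (bd P 0)) (tensor_map X (image_corestr (bd P 0)) y).
  by apply/esym/tensor_map_comp.
have cex : exact_at (tensor_map X (bd P 1)) (tensor_map X (image_corestr (bd P 0))).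
  apply: tensor_map_exact; first exact: image_corestr_onto.
  exact: (@aug_exact _ _ (res_shift P)).
rewrite ey -cex; split=> [|->]; last exact: raddf0.
exact: (e _ _ _ _ (Pp 0%N) (ses_res P)).
Qed.

(** To pass from resolutions to an arbitrary presentation of N, splice a free resolution of the
    kernel onto it. *)
Lemma Tor_eq0E k X N : Tor_eq0 k.+1 X N <-> tor0 k X N.
Proof.
split=> [|e P Pp]; last exact: tor0_res.
elim: k N => [|k ih] N e K G i p Gp hs; last first.
  apply: ih => P Pp; apply: (e (res_cons hs P)); exact: res_cons_proj.
move=> t it; have Fp := @free_resolution_proj _ K.
have ao := @aug_surj _ _ (free_resolution K).
have aex := @aug_exact _ _ (free_resolution K).
have [y yt] := tensor_map_onto (C := X) ao t.
have /(e _ (res_cons_proj (h := hs) Gp Fp))[z zy] :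
    tensor_map X (bd (res_cons hs (free_resolution K)) 0) y = 0.
  by rewrite -(tensor_map_comp (g := aug (free_resolution K)) (g' := i)) // yt.
by rewrite -yt; apply/(tensor_map_exact ao aex); exists z.
Qed.

(** Shifting in the first variable reduces to Tor_1(X1, D) with X1 a syzygy of X. There the
    vanishing of Tor_1(X, A) and flatness of the free cover make X1 (x) A -> X1 (x) B injective. *)
Lemma tor0_les k X A (B D : lmodType T) (i : {linear A -> B}) (p : {linear B -> D}) :
  ses i p -> tor0 k X A -> tor0 k.+1 X B -> tor0 k.+1 X D.
Proof.
have Fp Y := @projective_free_cover _ Y; have Fs Y := @ses_free_cover _ Y.
move=> hp; elim: k X => [|k ih] X eA /(tor0S_first (Fs X) (Fp X)) eB.
  apply/(tor0S_first (Fs X) (Fp X)); set X1 := free_syzygy X in eB *.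
  apply/(tor0_first (Fs X1) (Fp X1)).
  apply: (tensor_ses_syml (Fs X1) hp); first exact/(tor0_first (Fs X1) (Fp X1)).
  move=> t it; apply: (iffLR (tor0_first (Fs X) (Fp X) A) eA).
  have [ii _ _] := hp; apply: (tensor_map_flat (Fp X) ii).
  by rewrite -tensor_mapl_map it raddf0.
apply/(tor0S_first (Fs X) (Fp X))/ih => //.
exact/(tor0S_first (Fs X) (Fp X)).
Qed.

Lemma tor0_iso k X A N (f : {linear A -> N}) : injective f -> onto f ->
  tor0 k X A -> tor0 k X N.
Proof.
move=> fi fo; have [|g gE] := lift_through_inj (f := idfun : {linear N -> N}) fi.
  exact: fo.
have gf x : g (f x) = x by apply: fi; rewrite gE.
have hg K G (i : {linear K -> G}) (p : {linear G -> N}) : ses i p -> ses i (g \o p).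
  case=> ii po ex; split=> // [x|y].
    by have [y yE] := po (f x); exists y; rewrite /= yE gf.
  rewrite -ex /=; split=> [e|->]; last exact: linear0.
  by rewrite -[LHS]gE e; exact: linear0.
by case: k => [|k] e K G i p Gp /hg hs; exact: (e _ _ _ _ Gp hs).
Qed.

Lemma tor0_length (Xc : lmodType T -> Prop) X N n :
  (forall A, Xc A -> forall k, tor0 k X A) -> has_resolution_of_length Xc N n ->
  forall k, (n <= k)%N -> tor0 k X N.
Proof.
move=> e; elim: n N => [|n ih] N.
  move=> /resolution_length0_inv[A XA [f [fi fo]]] k _.
  by apply: (tor0_iso fi fo); exact: e.
move=> /resolution_lengthS_inv[K [A [i [p [hs XA /ih eK]]]]] [|k] // nk.
by apply: (tor0_les hs); [exact: eK | exact: e].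
Qed.

Lemma tor0_pd X N n : has_resolution_of_length (@projective T^c) X n ->
  forall k, (n <= k)%N -> tor0 k X N.
Proof.
elim: n X => [|n ih] X.
  move=> /resolution_length0_inv[A Ap [f [fi fo]]] k _; apply: tor0_projectivel.
  have [|g gE] := lift_through_inj (f := idfun : {linear X -> X}) fi; first exact: fo.
  exact: (retract_projective gE Ap).
move=> /resolution_lengthS_inv[K [A [i [p [hs Ap /ih eK]]]]] [|k] // nk.
by apply/(tor0S_first hs Ap); exact: eK.
Qed.

End Tor.

(** * Finitely presented flat modules and projective dimension *)

Lemma fin_gen_onto (T : pzRingType) (U V : lmodType T) (f : {linear U -> V}) :
  onto f -> fin_gen U -> fin_gen V.
Proof.
move=> fo [k [g gE]]; exists k, (fun i => f (g i)) => x.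
have [y <-] := fo x; have [a ->] := gE y; exists a.
by rewrite linear_sum; apply: eq_bigr => i _; rewrite linearZ.
Qed.

Lemma fin_gen_dual_basis (T : pzRingType) (F : lmodType T) :
  projective F -> fin_gen F ->
  exists (r : nat) (phi : 'I_r -> {linear F -> T^o}) (e : 'I_r -> F),
    forall x, x = \sum_j (phi j x : T) *: e j.
Proof.
move=> Fp [r [e eE]].
have pl : linear (fun v : 'rV[T]_r => \sum_j v 0 j *: e j).
  move=> a u v; rewrite scaler_sumr -big_split; apply: eq_bigr => j _.
  by rewrite !mxE scalerDl scalerA.
have [|s sE] := Fp _ _ (linear_of pl) idfun.
  move=> x; have [a ->] := eE x; exists (\row_j a j) => /=.
  by apply: eq_bigr => j _; rewrite mxE.
have cl j : linear (fun x : F => s x 0 j : T^o).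
  by move=> a x y; rewrite linearP !mxE.
by exists r, (fun j => linear_of (cl j)), e => x; rewrite -[LHS]sE.
Qed.

(* Flatness of X makes a relation matrix of X' in F solvable inside X', by     *)
(* testing against the left module presented by the transposed matrix.         *)
Lemma flat_fin_presented_projective (T : pzRingType) (X' F X : lmodType T^c)
    (j : {linear X' -> F}) (q : {linear F -> X}) :
  ses j q -> projective F -> fin_gen F -> fin_gen X' ->
  (forall N : lmodType T, tor0 0 X N) -> projective X.
Proof.
move=> hs Fp Ff [k [x xE]] flat; have [ji qo qex] := hs.
have [l [phi [e eE]]] := fin_gen_dual_basis Fp Ff.
(* Column i holds the coordinates in F of the generator x_i of X'; the test module N is the cokernel
   of v |-> v M. *)
pose M : 'M[T]_(l, k) := \matrix_(b, i) (phi b (j (x i)) : T).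
have Al : linear (fun v : 'rV[T]_l => v *m M).
  by move=> a u v; rewrite mulmxDl scalemxAl.
have [N [p [po pex]]] := linear_coker (linear_of Al).
pose eps i : 'rV[T]_k := delta_mx 0 i.
have peps b : \sum_i (phi b (j (x i)) : T) *: p (eps i) = 0.
  rewrite -[RHS](_ : p (row b M) = 0); last first.
    by apply/pex; exists (delta_mx 0 b); rewrite /= -rowE.
  rewrite [row b M]row_sum_delta linear_sum; apply: eq_bigr => i _.
  by rewrite linearZ !mxE.
(* This universal element becomes zero in F (x) N, because the rows of M are relations in N; by
   flatness of X it is already zero in X' (x) N, so it comes from some u in X' (x) T^l. *)
pose t := \sum_i tens (x i) (eps i).
have jt : tensor_mapl j (tensor_map X' p t) = 0.
  have -> : tensor_map X' p t = \sum_i tens (x i) (p (eps i)).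
    by rewrite raddf_sum; apply: eq_bigr => i _; exact: tensor_mapE.
  transitivity (\sum_i \sum_b tens ((phi b (j (x i)) : T^c) *: e b) (p (eps i))).
    rewrite raddf_sum; apply: eq_bigr => i _.
    by rewrite [LHS]tensor_maplE -tens_suml -eE.
  rewrite exchange_big big1 // => b _.
  under eq_bigr do rewrite tensZ.
  by rewrite -tens_sumr peps tensr_linear0.
have /(tensor_map_exact (C := X') po pex)[u uE] : tensor_map X' p t = 0.
  exact: (iffLR (tor0_first hs Fp N) (flat N)).
have cl n (i : 'I_n) : linear (fun v : 'rV[T]_n => v 0 i : T^o).
  by move=> a v w; rewrite !mxE.
pose c n (i : 'I_n) := coordr X' (linear_of (cl n i)).
have cT n (i : 'I_n) d v : c n i (tens d v) = (v 0 i : T^c) *: d.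
  exact: coordr_tens.
have ct i : c k i t = x i.
  rewrite raddf_sum (bigD1 i) // big1 => [|i' ii'].
    by rewrite cT mxE !eqxx scale1r; exact: addr0.
  by rewrite cT mxE eqxx [i == _]eq_sym (negPf ii') scale0r.
have cA i z : c k i (tensor_map X' (linear_of Al) z) =
    \sum_b (phi b (j (x i)) : T^c) *: c l b z.
  elim/tensor_ind: z => [|d v z ih].
    by rewrite !raddf0 big1 // => b _; rewrite [X in _ *: X]raddf0; exact: scaler0.
  rewrite raddfD [c k i _]raddfD ih.
  under [in RHS]eq_bigr do rewrite [X in _ *: X]raddfD scalerDr.
  rewrite big_split; congr (_ + _).
  rewrite [X in c k i X](tensor_mapE _ d v) cT mxE scaler_suml; apply: eq_bigr => b _.
  by rewrite cT scalerA mxE.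
(* Comparing i-th coordinates of t and of the image of u solves the relations inside X'; the
   solution defines a retraction r of j, so X is a direct summand of F. *)
have xy i : x i = \sum_b (phi b (j (x i)) : T^c) *: c l b u by rewrite -cA uE ct.
have rl : linear (fun z : F => \sum_b (phi b z : T^c) *: c l b u).
  move=> a y z; rewrite scaler_sumr -big_split; apply: eq_bigr => b _ /=.
  by rewrite scalerA -scalerDl linearP.
pose r := linear_of rl.
have rj z : r (j z) = z.
  have [a ->] := xE z; rewrite !linear_sum; apply: eq_bigr => i _.
  by rewrite !linearZ; congr (_ *: _); rewrite [RHS]xy.
have [w wE] := linear_sub (idfun : {linear F -> F}) (j \o r).
have [|s sE] := factor_through_onto (f := w) qo.
  by move=> z /qex[y <-]; apply/eqP; rewrite wE subr_eq0; apply/eqP/esym/(congr1 j (rj y)).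
apply: (@retract_projective _ _ _ s q) => // z.
have [y <-] := qo z; rewrite sE wE linearB /= (ses_comp0 _ hs).
exact: subr0.
Qed.

(** Each step passes to the first syzygy and lowers n by one; at n = 0 the module is flat and
    finitely presented. *)
Lemma projective_length_of_tor0 (T : pzRingType) (X : lmodType T^c)
    (P : resolution X) n :
  fg_proj_resolution P -> (forall k N, (n <= k)%N -> tor0 k X N) ->
  has_resolution_of_length (@projective T^c) X n.
Proof.
have imf (Y : lmodType T^c) (Q : resolution Y) :
    fg_proj_resolution Q -> fin_gen (image_mod (bd Q 0)).
  by move=> Qf; apply: (fin_gen_onto (@image_corestr_onto _ _ _ _)); case: (Qf 1%N).
elim: n X P => [|n ih] X P Pf e; have [P0 P0f] := Pf 0%N.
  apply: resolution_length0; apply: (flat_fin_presented_projective (ses_res P)) => //.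
    exact: imf.
  by move=> N; exact: e.
apply: (resolution_lengthS (ses_res P)) => //; apply: (ih _ (res_shift P)).
  by move=> i; exact: Pf.
by move=> k N nk; apply/(tor0S_first (ses_res P) P0); exact: e.
Qed.

(** * The functor C (x) - with values in left R-modules *)

Section BimoduleTensor.
Variables (R S : pzRingType) (C : bimodule R S).
Local Notation CS := (rmod C : lmodType S^c).
Implicit Types (N M K Q : lmodType S).

Lemma btensor_ind N (P : btensor C N -> Prop) :
  P 0 -> (forall c x t, P t -> P (btens c x + t)) -> forall t, P t.
Proof. exact: (@tensor_ind _ (rmod C) N P). Qed.

Definition btensor_map_fun N M (g : {linear N -> M}) : btensor C N -> btensor C M :=
  tensor_map (rmod C) g.

Lemma btensor_mapE N M (g : {linear N -> M}) c x :
  btensor_map_fun g (btens c x) = btens c (g x).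
Proof. exact: (tensor_mapE (C := rmod C) g). Qed.

Lemma btensor_map_linear N M (g : {linear N -> M}) : linear (btensor_map_fun g).
Proof.
have gD : {morph btensor_map_fun g : t u / t + u} by exact: (raddfD (tensor_map (rmod C) g)).
have g0 : btensor_map_fun g 0 = 0 by exact: (raddf0 (tensor_map (rmod C) g)).
move=> r t u; rewrite gD; congr (_ + _).
elim/btensor_ind: t => [|c x t ih]; first by rewrite scaler0 g0 scaler0.
rewrite scalerDr !gD ih scalerDr; congr (_ + _).
rewrite btensor_mapE [r *: btens c x]btensor_scale_tens btensor_mapE.
exact/esym/btensor_scale_tens.
Qed.

Definition btensor_map N M (g : {linear N -> M}) : {linear btensor C N -> btensor C M} :=
  linear_of (btensor_map_linear g).

Lemma btensor_map_mu N M (g : {linear N -> M}) x c :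
  btensor_map g (mu C x c) = mu C (g x) c.
Proof. exact: btensor_mapE. Qed.

Lemma ses_btensor N M K (i : {linear K -> M}) (p : {linear M -> N}) :
  projective M -> ses i p -> tor0 0 CS N -> ses (btensor_map i) (btensor_map p).
Proof.
move=> Mp hs e; have [_ po ex] := hs; split.
- exact: (linear_inj (f := btensor_map i) (e _ _ _ _ Mp hs)).
- exact: (tensor_map_onto (C := rmod C) po).
- exact: (tensor_map_exact (C := rmod C) po ex).
Qed.

Definition bcoord_fun Q (psi : {linear Q -> S^o}) : btensor C Q -> lmod C :=
  coordr (rmod C) psi.

Lemma bcoord_tens Q (psi : {linear Q -> S^o}) c x :
  bcoord_fun psi (btens c x) = ract c (psi x).
Proof. exact: (coordr_tens psi (c : rmod C) x). Qed.

Lemma bcoord_linear Q (psi : {linear Q -> S^o}) : linear (bcoord_fun psi).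
Proof.
have gD : {morph bcoord_fun psi : t u / t + u} by exact: (raddfD (coordr (rmod C) psi)).
have g0 : bcoord_fun psi 0 = 0 by exact: (raddf0 (coordr (rmod C) psi)).
move=> r t u; rewrite gD; congr (_ + _).
elim/btensor_ind: t => [|c x t ih]; first by rewrite scaler0 g0 scaler0.
rewrite scalerDr !gD ih scalerDr; congr (_ + _).
by rewrite [r *: btens c x]btensor_scale_tens !bcoord_tens ractZ.
Qed.

Definition bcoord Q (psi : {linear Q -> S^o}) : {linear btensor C Q -> lmod C} :=
  linear_of (bcoord_linear psi).

Lemma bcoord_mu Q (psi : {linear Q -> S^o}) x c : bcoord psi (mu C x c) = ract c (psi x).
Proof. exact: bcoord_tens. Qed.

Lemma mu_sum N (I : Type) (r : seq I) (F : I -> N) c :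
  mu C (\sum_(i <- r) F i) c = \sum_(i <- r) mu C (F i) c.
Proof. exact: (tens_sumr (c : rmod C) r F). Qed.

Lemma mu_scale N s (x : N) c : mu C (s *: x) c = mu C x (ract c s).
Proof. exact/esym/(tensZ s (c : rmod C) x). Qed.

(** The images of finitely many generators involve finitely many coordinates, so a map from P to C
    (x) Q is a finite sum of maps P -> C followed by maps mu(q). This reduces statements on C (x) Q
    to statements on C. *)
Lemma fin_gen_bcoord Q (phi : Q -> {linear Q -> S^o}) (P : lmodType R)
    (f : {linear P -> btensor C Q}) :
  fin_gen P -> dual_basis phi ->
  exists s : seq {classic Q},
    (forall q : {classic Q}, q \notin s -> forall x, bcoord (phi q) (f x) = 0) /\
    (forall x, f x = \sum_(q <- s) mu C (q : Q) (bcoord (phi q) (f x))).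
Proof.
move=> [k [g gE]] phiB.
have /choice[s sE] i := coordr_basis (X := rmod C) (f (g i)) phiB.
pose r := undup (flatten [seq s i | i <- enum 'I_k]).
have sr i : {subset s i <= r}.
  move=> q qs; rewrite mem_undup; apply/flattenP; exists (s i) => //.
  by apply: map_f; rewrite mem_enum.
have ext (V : lmodType R) (u v : {linear P -> V}) :
    (forall i, u (g i) = v (g i)) -> forall x, u x = v x.
  move=> uv x; have [a ->] := gE x; rewrite !linear_sum.
  by apply: eq_bigr => i _; rewrite !linearZ_LR uv.
exists r; split=> [q qr|].
  apply: (ext _ (bcoord (phi q) \o f) \0) => i.
  by apply: (sE i).1; apply: contra qr; exact: sr.
have cl : linear (fun t => \sum_(q <- r) mu C (q : Q) (bcoord (phi q) t)).
  by move=> a t u; rewrite scaler_sumr -big_split; apply: eq_bigr => q _; rewrite !linearP.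
by apply: (ext _ f (linear_of cl \o f)) => i; apply: (sE i).2 => //; exact: undup_uniq.
Qed.

(** * Semidualizing bimodules: mu and Ext on projectives and syzygies *)

Section Semidualizing.
Hypothesis hC : semidualizing C.

Lemma fin_gen_lmod : fin_gen (lmod C).
Proof.
by case: (sd_a1 hC) => P Pf; apply: (fin_gen_onto (@aug_surj _ _ P)); case: (Pf 0%N).
Qed.

Lemma ract_eq0 s : (forall c : lmod C, ract c s = 0) -> s = 0.
Proof.
move=> s0; apply: (bij_inj (sd_b2 hC)); apply: linear_eq => c.
rewrite [LHS](s0 c); apply: (addrI (ract c 0)).
by rewrite addr0 -[RHS]ractDr addr0.
Qed.

Lemma mu_projective_inj Q x : projective Q -> (forall c, mu C x c = 0) -> x = 0 :> Q.
Proof.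
move=> /projective_dual_basis[phi phiB] x0.
have [s [_ sE]] := phiB x; rewrite (sE (undup s)) ?undup_uniq //; last first.
  by move=> q; rewrite mem_undup.
rewrite big1 // => q _; rewrite (_ : phi q x = 0) ?scale0r //.
by apply: ract_eq0 => c; rewrite -bcoord_mu x0 linear0.
Qed.

(** The coordinates of [f] are R-endomorphisms of C, hence right multiplications by elements a_q of
    S by (b2); the preimage is the sum of the a_q q. *)
Lemma mu_projective_onto Q (f : {linear lmod C -> btensor C Q}) : projective Q ->
  exists x, forall c, mu C x c = f c.
Proof.
move=> /projective_dual_basis[phi phiB].
have [s [_ sE]] := fin_gen_bcoord f fin_gen_lmod phiB.
have [h _ hK] := sd_b2 hC.
pose a q := h (bcoord (phi q) \o f).
exists (\sum_(q <- s) a q *: (q : Q)) => c; rewrite mu_sum sE.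
apply: eq_bigr => q _; rewrite mu_scale.
by rewrite -[ract c (a q)]/(homothetyr C (a q) c) /a hK.
Qed.

(** A cocycle on a finitely generated term splits into finitely many C-valued cocycles, each a
    coboundary by (c1). *)
Lemma ext0_btensor_projective k Q : projective Q -> ext0 k (lmod C) (btensor C Q).
Proof.
move=> /projective_dual_basis[phi phiB]; have [P Pf] := sd_a1 hC.
have Pp : proj_resolution P by move=> i; case: (Pf i).
apply/(ext0_resP _ _ Pp) => f f0.
have [s [_ sE]] := fin_gen_bcoord f (Pf k.+1).2 phiB.
have /choice[h hE] (q : Q) : exists h : {linear res_term P k -> lmod C},
    forall x, bcoord (phi q) (f x) = h (bd P k x).
  apply: (sd_c1 hC (i := k.+1) isT Pp (bcoord (phi q) \o f)) => x.
  by rewrite [LHS](congr1 (bcoord (phi q)) (f0 x)) linear0.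
have gl : linear (fun y => \sum_(q <- s) mu C (q : Q) (h q y)).
  by move=> a y z; rewrite scaler_sumr -big_split; apply: eq_bigr => q _; rewrite !linearP.
by exists (linear_of gl) => x; rewrite sE; apply: eq_bigr => q _; rewrite hE.
Qed.

Definition tor_acyclic N : Prop := forall k, tor0 k CS N.

Lemma tor_acyclic_syzygy K Q N (i : {linear K -> Q}) (p : {linear Q -> N}) :
  projective Q -> ses i p -> tor_acyclic N -> tor_acyclic K.
Proof. by move=> Qp hs e k; exact: (e k.+1 _ _ _ _ Qp hs). Qed.

Section SyzygyMu.
Variables (K Q N : lmodType S) (i : {linear K -> Q}) (p : {linear Q -> N}).
Hypotheses (hs : ses i p) (Qp : projective Q) (tN : tor_acyclic N).

Lemma mu_syzygy_inj x : (forall c, mu C x c = 0) -> x = 0 :> K.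
Proof.
move=> x0; have [ii _ _] := hs; apply: ii; rewrite linear0.
by apply: mu_projective_inj => // c; rewrite -btensor_map_mu x0 linear0.
Qed.

(** The map C -> C (x) K -> C (x) Q is mu of some x in Q; it dies in C (x) N, so injectivity of mu_N
    puts x in K. *)
Lemma mu_syzygy_onto : (forall x : N, (forall c, mu C x c = 0) -> x = 0) ->
  forall f : {linear lmod C -> btensor C K}, exists x, forall c, mu C x c = f c.
Proof.
move=> muN f; have hb := ses_btensor Qp hs (tN 0).
have [x xE] := mu_projective_onto (btensor_map i \o f) Qp.
have [_ _ ex] := hs; have /ex[z zx] : p x = 0.
  by apply: muN => c; rewrite -btensor_map_mu xE; exact: ses_comp0 hb.
exists z => c; have [bi _ _] := hb; apply: bi.
by rewrite btensor_map_mu zx xE.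
Qed.

(** Surjectivity of mu_N writes a map C -> C (x) N as mu of an element, and lifting that element to
    Q lifts the map. *)
Lemma ext0_btensor_syzygy :
  (forall f : {linear lmod C -> btensor C N}, exists x, forall c, mu C x c = f c) ->
  ext0 0 (lmod C) (btensor C K).
Proof.
move=> muN; have hb := ses_btensor Qp hs (tN 0).
apply: (ext0_of_lift hb); last exact: ext0_btensor_projective.
move=> f; have [x xE] := muN f; have [_ po _] := hs; have [y yx] := po x.
by exists (mu C y) => c; rewrite btensor_map_mu yx xE.
Qed.

End SyzygyMu.

Fixpoint acyclic_syzygy (n : nat) (K : lmodType S) : Prop :=
  if n is n'.+1 then
    exists (N Q : lmodType S) (i : {linear K -> Q}) (p : {linear Q -> N}),
      [/\ acyclic_syzygy n' N, projective Q & ses i p]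
  else tor_acyclic K.

Lemma acyclic_syzygy_tor n K : acyclic_syzygy n K -> tor_acyclic K.
Proof.
elim: n K => [|n ih] K //= [N [Q [i [p [/ih tN Qp hs]]]]].
exact: tor_acyclic_syzygy hs tN.
Qed.

Lemma acyclic_syzygy_weaken n k K : acyclic_syzygy (n + k) K -> acyclic_syzygy n K.
Proof.
elim: n K => [|n ih] K; first exact: acyclic_syzygy_tor.
by case=> N [Q [i [p [/ih tN Qp hs]]]]; exists N, Q, i, p.
Qed.

(** Three syzygies pay for Ext^1: one for mu injective, one for mu onto, one for the vanishing. Each
    further one raises the degree by dimension shifting along C (x) Q. *)
Lemma ext0_btensor_acyclic_syzygy k K :
  acyclic_syzygy k.+3 K -> ext0 k (lmod C) (btensor C K).
Proof.
elim: k K => [|k ih] K [N [Q [i [p [sN Qp hs]]]]].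
  have tN := acyclic_syzygy_tor (n := 2) sN; apply: (ext0_btensor_syzygy hs Qp tN).
  case: sN => N1 [Q1 [i1 [p1 [sN1 Qp1 hs1]]]].
  apply: (mu_syzygy_onto hs1 Qp1 (acyclic_syzygy_tor (n := 1) sN1)).
  case: sN1 => N2 [Q2 [i2 [p2 [sN2 Qp2 hs2]]]].
  exact: (mu_syzygy_inj hs2 Qp2).
have tN := acyclic_syzygy_tor (n := k.+3) sN.
apply: (ext0_les_left (ses_btensor Qp hs (tN 0)) (ih _ sN)).
exact: ext0_btensor_projective.
Qed.

(** * The Auslander class equals the class of Tor-acyclic modules *)

Section UltimatelyClosedResolution.
Hypothesis hu : ultimately_closed (lmod C).

Lemma ext0_btensor_acyclic k K : tor_acyclic K -> ext0 k (lmod C) (btensor C K).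
Proof.
case: hu => m [_ um].
(* Index j < m needs a (j + 3)-rd syzygy, so m + 3 serves them all; ultimate closedness then covers
   every degree. *)
have base K' : acyclic_syzygy (m + 3) K' -> forall k, ext0 k (lmod C) (btensor C K').
  move=> sK; apply: (ultimately_closed_ext0 um) => j jm.
  apply: ext0_btensor_acyclic_syzygy; apply: (@acyclic_syzygy_weaken _ (m - j)).
  by rewrite -addn3 addnAC subnKC // ltnW.
(* Descent: if all (n + 1)-st syzygies have vanishing Ext, so do the n-th ones, by shifting along
   the free cover; at 0 this reaches every Tor-acyclic module. *)
suff desc n : (forall K', acyclic_syzygy n K' -> forall k, ext0 k (lmod C) (btensor C K')) ->
    forall K', acyclic_syzygy 0 K' -> forall k, ext0 k (lmod C) (btensor C K').
  by move=> tK; exact: (desc _ base K tK k).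
elim: n => // n ih h; apply: ih => K' sK j.
have Fp := @projective_free_cover _ K'; have Fs := @ses_free_cover _ K'.
have tK' := acyclic_syzygy_tor sK.
apply: (ext0_les_right (ses_btensor Fp Fs (tK' 0))).
  by apply: h; exists K', (free_cover K'), (ker_incl (free_cover_map K')), (free_cover_map K').
exact: ext0_btensor_projective.
Qed.

(** Ext^1 from C into C tensored with the free syzygy vanishes, so [f] lifts to the free cover,
    where mu is onto. *)
Lemma mu_acyclic_onto K (f : {linear lmod C -> btensor C K}) : tor_acyclic K ->
  exists x, forall c, mu C x c = f c.
Proof.
move=> tK; have Fp := @projective_free_cover _ K; have Fs := @ses_free_cover _ K.
have [|g gE] := ext0_lift (ses_btensor Fp Fs (tK 0)) f.
  exact/ext0_btensor_acyclic/(tor_acyclic_syzygy Fp Fs).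
have [y yE] := mu_projective_onto g Fp.
by exists (free_cover_map K y) => c; rewrite -btensor_map_mu yE gE.
Qed.

(** If y in the free cover lies over x, then mu(y) lands in C tensored with the syzygy and so equals
    mu(z) for some z there; injectivity of mu on the cover gives y = z, hence x = 0. *)
Lemma mu_acyclic_inj K x : tor_acyclic K -> (forall c, mu C x c = 0) -> x = 0 :> K.
Proof.
move=> tK x0; have Fp := @projective_free_cover _ K; have Fs := @ses_free_cover _ K.
have hb := ses_btensor Fp Fs (tK 0); have [_ po _] := Fs; have [y yx] := po x.
have [|g gE] := ses_lift (f := mu C y) hb.
  by move=> c; rewrite btensor_map_mu yx.
have [z zE] := mu_acyclic_onto g (tor_acyclic_syzygy Fp Fs tK).
have -> : x = free_cover_map K (y - ker_incl (free_cover_map K) z).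
  by rewrite linearB [X in _ - X](ses_comp0 _ Fs) subr0.
rewrite (_ : y - _ = 0) ?linear0 //; apply: mu_projective_inj => // c.
rewrite [LHS](tensB (c : rmod C) y); apply/eqP; rewrite subr_eq0; apply/eqP.
by rewrite -[LHS]gE -zE btensor_map_mu.
Qed.

Lemma auslander_class_acyclic K : auslander_class C K <-> tor_acyclic K.
Proof.
split=> [[e _ _] k|tK]; first by apply/Tor_eq0E; exact: e.
split=> [[|k] // _|[|k] // _|]; first exact/Tor_eq0E.
  exact/Ext_eq0E/ext0_btensor_acyclic.
apply: inj_onto_bijective => [x y xy|f].
  apply/eqP; rewrite -subr_eq0; apply/eqP/mu_acyclic_inj => // c.
  have {}xy := congr1 (fun g : {linear _ -> _} => g c) xy.
  by rewrite [LHS](tensB (c : rmod C) x) [X in X - _]xy subrr.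
have [x xE] := mu_acyclic_onto f tK.
by exists x; apply: linear_eq.
Qed.

Lemma auslander_length n N : (forall k, (n <= k)%N -> tor0 k CS N) ->
  has_resolution_of_length (auslander_class C) N n.
Proof.
elim: n N => [|n ih] N e.
  by apply/resolution_length0/auslander_class_acyclic => k; exact: e.
have Fp := @projective_free_cover _ N; have Fs := @ses_free_cover _ N.
apply: (resolution_lengthS Fs).
  by apply/auslander_class_acyclic => k; exact: tor0_projectiver.
by apply: ih => k nk; apply: (e k.+1 _ _ _ _ _ Fp Fs).
Qed.

End UltimatelyClosedResolution.
End Semidualizing.
End BimoduleTensor.

(** * Comparison of the two dimensions *)

Lemma le_inf_nat (A : nat -> Prop) n :
  le_dim (inf_nat A) n <-> exists2 k, (k <= n)%N & A k.
Proof.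
rewrite /inf_nat; case: pselect => [ex|nex] /=; last first.
  by split=> // -[k _ Ak]; apply: nex; exists k; apply/asboolP.
case: ex_minnP => m /asboolP Am m_min; split=> [mn|[k kn Ak]]; first by exists m.
by apply: leq_trans kn; apply/m_min/asboolP.
Qed.

Theorem corollary4p11 (R S : pzRingType) (C : bimodule R S)
    (hC : semidualizing C) (hu : ultimately_closed (lmod C)) (n : nat) :
  le_dim (pd (rmod C : lmodType S^c)) n <->
  (forall N : lmodType S, le_dim (auslander_pd C N) n).
Proof.
split=> [/le_inf_nat[k kn Ck] N|h].
  apply/le_inf_nat; exists k => //; apply: auslander_length => // j.
  exact: tor0_pd.
apply/le_inf_nat; exists n => //; have [P Pf] := sd_a2 hC.
apply: (projective_length_of_tor0 Pf) => j N nj.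
(* The resolution of N has some length k <= n, and its terms are Tor-acyclic, so Tor_(j+1)(C, N) = 0
   for all j >= n. *)
have /le_inf_nat[k kn lN] := h N.
apply: (tor0_length _ lN); last exact: leq_trans nj.
by move=> A /(auslander_class_acyclic hC hu) tA i; exact: tA.
Qed.
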